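(* Let $n,m\ge 1$ be integers, let $1\le p_0<\infty$, and let $\mathbb{X}$ be a quasi-Banach function space on $\mathbb{R}^n$. Then there is a constant $C$, which may depend on $\mathbb{X}$ (and on $n,m,p_0$) but not on $k$, $\mathcal{S}$ or $\vec f$, such that the following holds. For every integer $k\ge 0$, every sparse family $\mathcal{S}$ of cubes in a dyadic grid, and every $m$-tuple $\vec f=(f_1,\dots,f_m)$ of measurable functions on $\mathbb{R}^n$, there exists another sparse family $\mathcal{S}'$ (contained in some dyadic grid) such that $$\|\mathcal{T}^{k,p_0}_{\mathcal{S}}(\vec f)\|_{\mathbb{X}}\le C\,(k+1)\,\|\mathcal{A}^{0,p_0}_{\mathcal{S}'}(\vec f)\|_{\mathbb{X}} .$$
   Context: Dyadic grid: a collection $\mathscr{D}$ of cubes in $\mathbb{R}^n$ with sides parallel to the axes such that every $Q\in\mathscr{D}$ has side length $2^j$ for some $j\in\mathbb{Z}$; any two cubes of $\mathscr{D}$ are either nested or disjoint; and for each $j\in\mathbb{Z}$ the cubes in $\mathscr{D}$ of side length $2^j$ partition $\mathbb{R}^n$. Sparse family: a collection $\mathcal{S}\subset\mathscr{D}$ for which there exist pairwise disjoint measurable sets $E_Q\subset Q$ ($Q\in\mathcal{S}$) with $|Q|\le 2|E_Q|$. For a cube $Q$, $\langle f\rangle_{Q,p_0}:=\big(\frac1{|Q|}\int_Q|f(x)|^{p_0}\,dx\big)^{1/p_0}$, and $2^kQ$ is the cube concentric with $Q$ with side length $2^k$ times that of $Q$. Define $$\mathcal{T}^{k,p_0}_{\mathcal{S}}(\vec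 f)(x)=\sum_{Q\in\mathcal{S}}\Big[\prod_{i=1}^m\langle f_i\rangle_{2^kQ,p_0}\Big]\chi_Q(x),\qquad \mathcal{A}^{0,p_0}_{\mathcal{S}}(\vec f)(x)=\sum_{Q\in\mathcal{S}}\Big[\prod_{i=1}^m\langle f_i\rangle_{Q,p_0}\Big]\chi_Q(x).$$ Quasi-Banach function space: a complete space $\mathbb{X}$ of (classes of) measurable functions on $\mathbb{R}^n$ with a quasi-norm $\|\cdot\|_{\mathbb{X}}$ (i.e. a norm except that the triangle inequality is replaced by $\|f+g\|_{\mathbb X}\le C_{\mathbb{X}}(\|f\|_{\mathbb X}+\|g\|_{\mathbb X})$), having the lattice property ($|f|\le|g|$ a.e. implies $\|f\|_{\mathbb X}\le\|g\|_{\mathbb X}$), the Fatou property ($0\le f_j\uparrow f$ a.e. implies $\|f_j\|_{\mathbb X}\uparrow\|f\|_{\mathbb X}$), and $\|\chi_E\|_{\mathbb X}<\infty$ for bounded measurable sets $E$. One sets $\|f\|_{\mathbb X}=\infty$ if $f\notin\mathbb X$. *)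

(* Defs.v *)
From HB Require Import structures.
From mathcomp Require Import all_boot all_order all_algebra.
From mathcomp Require Import all_classical all_reals all_analysis.
From mathcomp Require Import measurable_realfun.

Set Implicit Arguments.
Unset Strict Implicit.
Unset Printing Implicit Defensive.

Import Order.TTheory GRing.Theory Num.Theory.
Import numFieldNormedType.Exports.

Local Open Scope classical_set_scope.
Local Open Scope ring_scope.
Local Open Scope ereal_scope.

Section lebesgue_tuple_step.
Context {R : realType} (n : nat).
Variable mu : {sigma_finite_measure set (n.-tuple R) -> \bar R}.

Definition tuple_cons (p : R * n.-tuple R) : n.+1.-tuple R :=
  [tuple of p.1 :: p.2].

Lemma measurable_tuple_cons : measurable_fun setT tuple_cons.
Proof. exact: measurable_cons. Qed.

Lemma measurable_tuple_uncons :
  measurable_fun setT (fun x : n.+1.-tuple R => (thead x, [tuple of behead x])).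
Proof.
apply/measurable_fun_pairP; split => /=; first exact: measurable_tnth.
apply/measurable_fun_tnthP => i.
rewrite (_ : _ \o _ = fun x : n.+1.-tuple R => tnth x (lift ord0 i)).
  exact: measurable_tnth.
apply/funext => x /=; rewrite tnth_behead; congr tnth.
by apply/val_inj; rewrite /= inordK// ltnS.
Qed.

Definition lebesgue_step : set (n.+1.-tuple R) -> \bar R :=
  pushforward (lebesgue_measure \x mu) tuple_cons.

Let lebesgue_step0 : lebesgue_step set0 = 0.
Proof.
have pf0 := measure0 (pushforward (lebesgue_measure \x mu) tuple_cons).
exact: pf0 measurable_tuple_cons.
Qed.

Let lebesgue_step_ge0 A : 0 <= lebesgue_step A.
Proof. by rewrite /lebesgue_step /pushforward; apply: measure_ge0. Qed.

Let lebesgue_step_sigma_additive : semi_sigma_additive lebesgue_step.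
Proof.
have pfD := @measure_semi_sigma_additive _ _ _
  (pushforward (lebesgue_measure \x mu) tuple_cons).
exact: pfD measurable_tuple_cons.
Qed.

HB.instance Definition _ := isMeasure.Build _ _ _ lebesgue_step
  lebesgue_step0 lebesgue_step_ge0 lebesgue_step_sigma_additive.

Let lebesgue_step_sigma_finite : sigma_finite setT lebesgue_step.
Proof.
have /sigma_finiteP[F [TF ndF Foo]] := sigma_finiteT (@lebesgue_measure R).
have /sigma_finiteP[G [TG ndG Goo]] := sigma_finiteT mu.
pose uncons (x : n.+1.-tuple R) := (thead x, [tuple of behead x]).
have tuple_consK p : uncons (tuple_cons p) = p.
  by case: p => a b; congr pair; apply/val_inj.
exists (fun k => uncons @^-1` (F k `*` G k)).
  rewrite -preimage_bigcup (_ : \bigcup_k _ = setT) ?preimage_setT//.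
  rewrite -setXTT TF TG predeqE => -[x y]; split=> [[k _ []/= ? ?]|].
    by split; exists k.
  move=> [/= [k _ Fkx] [l _ Gly]]; exists (maxn k l) => //; split.
  - by move: x Fkx; exact/subsetPset/ndF/leq_maxl.
  - by move: y Gly; exact/subsetPset/ndG/leq_maxr.
move=> k; have [mF Fk] := Foo k; have [mG Gk] := Goo k; split.
  rewrite -[X in measurable X]setTI.
  by apply: measurable_tuple_uncons => //; exact: measurableX.
rewrite /lebesgue_step /pushforward (_ : _ @^-1` _ = F k `*` G k).
  by rewrite product_measure1E// lte_mul_pinfty// ge0_fin_numE.
apply/funext => p; transitivity ((F k `*` G k) (uncons (tuple_cons p))) => //.
by rewrite tuple_consK.
Qed.

HB.instance Definition _ := Measure_isSigmaFinite.Build _ _ _ lebesgue_step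
  lebesgue_step_sigma_finite.

End lebesgue_tuple_step.

Fixpoint borel_lebesgue (R : realType) (n : nat) :
    {sigma_finite_measure set (n.-tuple R) -> \bar R} :=
  match n with
  | 0 => \d_[tuple]
  | n'.+1 => lebesgue_step (borel_lebesgue R n')
  end.

(* R^n with the Lebesgue (i.e. Caratheodory) sigma-algebra of the completion of
   the n-fold product of the one-dimensional Lebesgue measure. *)
Definition eucl (R : realType) (n : nat) : measurableType _ :=
  caratheodory_type ((borel_lebesgue R n)^*)%mu.

Definition leb (R : realType) (n : nat) : {measure set (eucl R n) -> \bar R} :=
  @completed_measure_extension _ _ _ (borel_lebesgue R n).

Section cubes.
Context {R : realType} {n : nat}.
Implicit Types (Q : n.-tuple R * R) (x : eucl R n).

(* A cube is given by its lower corner and its side length; following the usual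
   convention for dyadic grids, its set of points is half-open. *)
Definition corner Q (i : 'I_n) : R := tnth Q.1 i.
Definition side Q : R := Q.2.

Definition cube_set Q : set (eucl R n) :=
  [set x | forall i : 'I_n, (corner Q i <= tnth x i < corner Q i + side Q)%R].

Definition dilate (k : nat) Q : n.-tuple R * R :=
  ([tuple (corner Q i + side Q / 2 - 2 ^+ k * side Q / 2)%R | i < n],
   (2 ^+ k * side Q)%R).

Definition dyadic_grid (D : set (n.-tuple R * R)) : Prop :=
  [/\ forall Q, D Q -> exists j : int, side Q = (2 ^ j)%R,
      forall Q Q', D Q -> D Q' ->
        [\/ cube_set Q `<=` cube_set Q', cube_set Q' `<=` cube_set Q
          | cube_set Q `&` cube_set Q' = set0]
    & forall j : int,
        partition [set Q | D Q /\ side Q = (2 ^ j)%R] cube_set setT].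

Definition sparse (S : set (n.-tuple R * R)) : Prop :=
  exists E : n.-tuple R * R -> set (eucl R n),
    [/\ forall Q, S Q -> measurable (E Q),
        forall Q, S Q -> E Q `<=` cube_set Q,
        trivIset S E
      & forall Q, S Q -> leb R n (cube_set Q) <= 2%:E * leb R n (E Q)].

Definition average (p0 : R) (f : eucl R n -> R) Q : \bar R :=
  ((leb R n (cube_set Q))^-1 *
   \int[leb R n]_(x in cube_set Q) ((`|f x| `^ p0)%R)%:E) `^ p0^-1%R.

(* The operators take values in [0, +oo], with 0 * +oo = 0 in the products. *)
Definition opT (m k : nat) (p0 : R) (S : set (n.-tuple R * R))
    (f : 'I_m -> eucl R n -> R) : eucl R n -> \bar R := fun x =>
  \esum_(Q in S) ((\big[*%E/1]_(i < m) average p0 (f i) (dilate k Q)) *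
                  (\1_(cube_set Q) x)%:E).

Definition opA (m : nat) (p0 : R) (S : set (n.-tuple R * R))
    (f : 'I_m -> eucl R n -> R) : eucl R n -> \bar R := fun x =>
  \esum_(Q in S) ((\big[*%E/1]_(i < m) average p0 (f i) Q) *
                  (\1_(cube_set Q) x)%:E).

End cubes.

(* Extension of a function N on X to all extended-real-valued functions: the
   value at f is N g for any g in X equal to f a.e., and +oo (the infimum of the
   empty set) when no such g exists. In a quasi-Banach function space the lattice
   property makes the value independent of g. *)
Definition ext_norm (R : realType) (n : nat) (X : set (eucl R n -> R))
    (N : (eucl R n -> R) -> R) (f : eucl R n -> \bar R) : \bar R :=
  ereal_inf [set (N g)%:E | g in
    [set g | X g /\ {ae leb R n, forall x, f x = (g x)%:E}]].

(* Classes of functions modulo a.e. equality are represented by a set of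
   functions; qbfs_lattice makes it and the quasi-norm invariant under a.e.
   equality of measurable functions. *)
Record qbfs (R : realType) (n : nat) := QBFS {
  qbfs_mem : set (eucl R n -> R);
  qbfs_norm : (eucl R n -> R) -> R;
  qbfs_measurable : forall f, qbfs_mem f -> measurable_fun setT f;
  qbfs_add : forall f g, qbfs_mem f -> qbfs_mem g ->
    qbfs_mem (fun x => f x + g x)%R;
  qbfs_scale : forall (c : R) f, qbfs_mem f -> qbfs_mem (fun x => c * f x)%R;
  qbfs_norm_ge0 : forall f, qbfs_mem f -> (0 <= qbfs_norm f)%R;
  qbfs_norm_eq0 : forall f, qbfs_mem f ->
    qbfs_norm f = 0%R <-> {ae leb R n, forall x, f x = 0%R};
  qbfs_normZ : forall (c : R) f, qbfs_mem f ->
    qbfs_norm (fun x => c * f x)%R = (`|c| * qbfs_norm f)%R;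
  qbfs_quasi_triangle : exists C : R, forall f g, qbfs_mem f -> qbfs_mem g ->
    (qbfs_norm (fun x => f x + g x) <= C * (qbfs_norm f + qbfs_norm g))%R;
  qbfs_complete : forall u : nat -> eucl R n -> R,
    (forall j, qbfs_mem (u j)) ->
    (forall e : R, (0 < e)%R -> exists N : nat, forall i j : nat,
       (N <= i)%N -> (N <= j)%N ->
       (qbfs_norm (fun x => u i x - u j x) < e)%R) ->
    exists2 f, qbfs_mem f &
      qbfs_norm (fun x => u j x - f x)%R @[j --> \oo] --> (0%R : R);
  qbfs_lattice : forall f g : eucl R n -> R, measurable_fun setT f -> qbfs_mem g ->
    {ae leb R n, forall x, (`|f x| <= `|g x|)%R} ->
    qbfs_mem f /\ (qbfs_norm f <= qbfs_norm g)%R;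
  qbfs_fatou : forall (u : nat -> eucl R n -> \bar R) (f : eucl R n -> \bar R),
    (forall j, measurable_fun setT (u j)) -> measurable_fun setT f ->
    {ae leb R n, forall x, [/\ forall j, 0 <= u j x,
       nondecreasing_seq (u ^~ x) & u j x @[j --> \oo] --> f x]} ->
    ext_norm qbfs_mem qbfs_norm (u j) @[j --> \oo] -->
    ext_norm qbfs_mem qbfs_norm f;
  qbfs_indic : forall E : set (eucl R n), measurable E ->
    (exists M : R, forall x, E x -> forall i : 'I_n, (`|tnth x i| <= M)%R) ->
    qbfs_mem (\1_E : eucl R n -> R) }.

Definition qnorm (R : realType) (n : nat) (X : qbfs R n) :
    (eucl R n -> \bar R) -> \bar R :=
  ext_norm (@qbfs_mem R n X) (@qbfs_norm R n X).

(* Main.v *)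
(* Each 2^k Q lies in a cube P(Q) of comparable size of one of 2^n shifted dyadic
   grids. One works in each grid separately: the quasi-triangle inequality over
   the 2^n grids, whose number does not depend on k, only costs a constant.
   In a grid, sparse cubes are selected by a stopping time. Below a selected P0
   one stops at P when the mean of some |f_l|^p0 over P is much larger than over
   P0, or when P meets a cube Q of S, no smaller than P, that is contained in at
   least N cubes Q' of S with P(Q') inside P0, where N depends on n only. By the
   weak type (1,1) of the dyadic maximal function and the Carleson property of S,
   the stopping cubes fill a small part of P0. Before stopping, a point of P0 is
   in at most N + k + 2 cubes Q with P(Q) inside P0: the first N of them make P
   stop as soon as P is no larger than the N-th one, and P(Q) is 2^(k+3) times
   larger than Q at most. *)
Require Import Defs.
From mathcomp Require Import all_boot all_order all_algebra.
From mathcomp Require Import all_classical all_reals all_analysis.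
From mathcomp Require Import finmap measurable_realfun.
From mathcomp Require Import zify ring lra.

Set Implicit Arguments.
Unset Strict Implicit.
Unset Printing Implicit Defensive.

Import Order.TTheory GRing.Theory Num.Theory.
Import numFieldNormedType.Exports.

Local Open Scope classical_set_scope.
Local Open Scope ring_scope.
Local Open Scope ereal_scope.

(** * Lebesgue measure of half-open boxes and cubes *)

Section measure_cube.
Context {R : realType}.

Definition box n (a b : 'I_n -> R) : set (n.-tuple R) :=
  [set x | forall i, (a i <= tnth x i < b i)%R].

Lemma measurable_box n (a b : 'I_n -> R) : measurable (box a b).
Proof.
rewrite (_ : box a b = \bigcap_(i in [set: 'I_n])
    ((fun x : n.-tuple R => tnth x i) @^-1` `[a i, b i[%classic)); last first.
  apply/seteqP; split=> [x xab i _|x xab i].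
    by rewrite /= in_itv/= xab.
  by have := xab i I; rewrite /= in_itv.
apply: fin_bigcap_measurable => // i _.
rewrite -[X in measurable X]setTI.
exact: (measurable_tnth i) measurableT _ (measurable_itv _).
Qed.

Lemma borel_lebesgue_box n (a b : 'I_n -> R) : (forall i, a i <= b i)%R ->
  borel_lebesgue R n (box a b) = (\prod_(i < n) (b i - a i))%:E.
Proof.
elim: n a b => [|n IH] a b ab.
  rewrite big_ord0 /= diracE mem_set//.
  by move=> -[].
rewrite big_ord_recl/= /lebesgue_step /pushforward.
rewrite (_ : _ @^-1` _ = `[a ord0, b ord0[%classic `*`
    box (fun i => a (lift ord0 i)) (fun i => b (lift ord0 i))).
  rewrite product_measure1E//; last exact: measurable_box.
  rewrite [X in _ * X]IH// EFinM; congr *%E.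
  rewrite [LHS](@lebesgue_measure_itv R `[a ord0, b ord0[) /= lte_fin.
  case: ltP => // h.
  have -> : a ord0 = b ord0 by apply/le_anti; rewrite h ab.
  by rewrite subrr.
apply/seteqP; split=> [[x y] /= h|[x y] /= [h1 h2] i].
  split; first by have := h ord0; rewrite in_itv.
  move=> i; have := h (lift ord0 i).
  by rewrite tnthS.
case: (unliftP ord0 i) => [j ->|->]; first by rewrite tnthS.
by move: h1; rewrite in_itv.
Qed.

Lemma measurable_cube n (Q : n.-tuple R * R) : measurable (cube_set Q).
Proof.
apply: caratheodory_measurable_mu_ext.
exact: (measurable_box (fun i => corner Q i) (fun i => corner Q i + side Q)%R).
Qed.

Lemma leb_cube n (Q : n.-tuple R * R) : (0 <= side Q)%R ->
  leb R n (cube_set Q) = (side Q ^+ n)%:E.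
Proof.
move=> Q0; rewrite /leb /=.
have mQ := measurable_box (fun i => corner Q i) (fun i => corner Q i + side Q)%R.
apply: (etrans (measurable_mu_extE _ mQ)).
apply: etrans (borel_lebesgue_box _) _; first by move=> i; rewrite lerDl.
under eq_bigr do rewrite addrC addKr.
by rewrite prodr_const card_ord.
Qed.

Lemma le_leb n (A B : set (eucl R n)) : measurable A -> measurable B ->
  A `<=` B -> leb R n A <= leb R n B.
Proof. by move=> mA mB AB; apply: le_measure => //; exact: mem_set. Qed.

End measure_cube.

(** * Shifted dyadic grids and the one-third trick *)

Lemma exprN1z (R : realType) (j : int) :
  ((-1 : R) ^ j = 1 \/ (-1 : R) ^ j = -1)%R.
Proof.
case: j => k; rewrite ?NegzE -?exprnP -?exprnN -signr_odd;
  by case: (odd _); rewrite ?(expr0, expr1, invr1, invrN1); auto.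
Qed.

(** Equal floors mean that no integer threshold separates [u] from [v]. Nesting of cubes and
    exhaustion of space are both checked in this form. *)
Lemma floor_eq_ge (R : realType) (u v : R) : Num.floor u = Num.floor v <->
  forall N : int, (N%:~R <= u)%R = (N%:~R <= v)%R.
Proof.
split=> [uv N|uv]; first by rewrite -!floor_ge_int uv.
by apply/le_anti; rewrite !floor_ge_int -uv floor_le uv floor_le.
Qed.

Section shifted_grid.
Context {R : realType} {n : nat}.
Implicit Types (b : {ffun 'I_n -> bool}) (j : int) (x y : n.-tuple R).

(* Twice shift j is shift (j - 1) up to an integer, which makes the cubes nested;
   no point is a face point at all large scales, so that the cubes containing the
   origin exhaust the space; and two choices of the sign b l move the faces of
   each scale apart by a third of the side. *)
Definition shift b j (l : 'I_n) : R := ((-1) ^+ b l * (-1) ^ j / 3)%R.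

(** Two points share a cube of side [2 ^ j] exactly when their indices agree, so that the geometry
    of the grid reduces to floors. *)
Definition gidx b j x : n.-tuple int :=
  [tuple Num.floor (tnth x l / 2 ^ j - shift b j l)%R | l < n].

Definition gcube b j (z : n.-tuple int) : n.-tuple R * R :=
  ([tuple (2 ^ j * ((tnth z l)%:~R + shift b j l))%R | l < n], (2 ^ j)%R).

Definition cube_at b j x := gcube b j (gidx b j x).

Definition grid b : set (n.-tuple R * R) :=
  [set Q | exists j z, Q = gcube b j z].

Lemma exp2z_gt0 j : (0 < 2 ^ j :> R)%R.
Proof. by rewrite exprz_gt0. Qed.

Lemma in_gcube b j z x : cube_set (gcube b j z) x <-> gidx b j x = z.
Proof.
have j0 := exp2z_gt0 j.
have key l : (corner (gcube b j z) l <= tnth x l <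
      corner (gcube b j z) l + side (gcube b j z))%R =
    (Num.floor (tnth x l / 2 ^ j - shift b j l)%R == tnth z l).
  rewrite /corner /side /= tnth_mktuple floor_eq.
  rewrite lerBrDr ltrBlDr ler_pdivlMr// ltr_pdivrMr// intrD.
  congr (_ && _); first by congr (_ <= _)%R; ring.
  by congr (_ < _)%R; ring.
split=> [h|zE l].
  by apply: eq_from_tnth => l; rewrite tnth_mktuple; apply/eqP; rewrite -key; exact: h.
have zl : tnth z l = Num.floor (tnth x l / 2 ^ j - shift b j l)%R.
  by rewrite -zE tnth_mktuple.
by have := key l; rewrite zl eqxx.
Qed.

Lemma mem_cube_at b j x : cube_set (cube_at b j x) x.
Proof. exact/in_gcube. Qed.

Lemma in_cube_at b j x y : cube_set (cube_at b j x) y <-> gidx b j y = gidx b j x.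
Proof. exact: in_gcube. Qed.

Lemma cube_at_eq b j x y : gidx b j x = gidx b j y -> cube_at b j x = cube_at b j y.
Proof. by rewrite /cube_at => ->. Qed.

(** If [u] is the shifted coordinate at scale [j], the one at scale [j + 1] is [u / 2] plus or minus
    [1 / 2]. An integer threshold for the latter is an integer threshold for [u], hence the new
    floor depends only on the floor of [u]. *)
Lemma gidx_succ b j x y : gidx b j x = gidx b j y ->
  gidx b (j + 1) x = gidx b (j + 1) y.
Proof.
move=> xy; apply: eq_from_tnth => l.
move: (congr1 (fun t => tnth t l) xy); rewrite !tnth_mktuple.
have j0 := exp2z_gt0 j.
have shE : shift b j l = (- shift b (j + 1) l)%R.
  by rewrite /shift expfzDr ?oppr_eq0 ?oner_eq0// expr1z; ring.
have vE (u : R) : (u / 2 ^ (j + 1) - shift b (j + 1) l =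
    (u / 2 ^ j - shift b j l) / 2 + 3 / 2 * shift b j l)%R.
  rewrite expfzDr// expr1z shE.
  by field; rewrite lt0r_neq0.
have [e eE] : exists e : bool, (3 / 2 * shift b j l = (-1) ^+ e / 2)%R.
  rewrite /shift; have [] := exprN1z R j.
  - by move=> ->; exists (b l); field.
  - by move=> ->; exists (~~ b l); case: (b l) => /=; field.
rewrite !vE eE.
move=> /floor_eq_ge uv; apply/floor_eq_ge => N.
rewrite -!lerBlDr !ler_pdivlMr//.
have -> : ((N%:~R - (-1) ^+ e / 2) * 2 = (N * 2 - (-1) ^+ e)%:~R :> R)%R.
  by rewrite intrD intrM intrN rmorphXn/= rmorphN1; field.
exact: uv.
Qed.

Lemma gidx_addn b j (d : nat) x y : gidx b j x = gidx b j y ->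
  gidx b (j + d%:Z) x = gidx b (j + d%:Z) y.
Proof.
move=> xy; elim: d => [|d IH]; first by rewrite addr0.
by rewrite -addn1 PoszD addrA; exact: gidx_succ.
Qed.

Lemma gidx_le b j j' x y : (j <= j')%R -> gidx b j x = gidx b j y ->
  gidx b j' x = gidx b j' y.
Proof.
move=> jj'; have -> : j' = (j + `|j' - j|%N%:Z)%R by lia.
exact: gidx_addn.
Qed.

Lemma exp2z_inj : injective (fun j : int => 2 ^ j : R)%R.
Proof. by apply: ieexprIz; rewrite // gt_eqF// ltr1n. Qed.

Lemma cube_at_sub b j j' x : (j <= j')%R ->
  cube_set (cube_at b j x) `<=` cube_set (cube_at b j' x).
Proof. by move=> jj' y /in_cube_at xy; apply/in_cube_at; exact: gidx_le xy. Qed.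

Lemma gcube_nonempty b j z : cube_set (gcube b j z) !=set0.
Proof.
exists [tuple (2 ^ j * ((tnth z l)%:~R + shift b j l))%R | l < n] => l.
rewrite /corner/= tnth_mktuple lexx ltrDl; exact: exp2z_gt0.
Qed.

Lemma grid_dyadic b : dyadic_grid (grid b).
Proof.
split.
- by move=> _ [j [z ->]]; exists j.
- have H j z j' z' : (j <= j')%R ->
    cube_set (gcube b j z) `<=` cube_set (gcube b j' z') \/
    cube_set (gcube b j z) `&` cube_set (gcube b j' z') = set0.
    move=> jj'; have [->|/set0P[x [/in_gcube xz /in_gcube xz']]] :=
      eqVneq (cube_set (gcube b j z) `&` cube_set (gcube b j' z')) set0; first by right.
    left=> y /in_gcube yz; apply/in_gcube; rewrite -xz'.
    by apply: gidx_le jj' _; rewrite yz.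
  move=> _ _ [j [z ->]] [j' [z' ->]].
  have [jj'|/ltW j'j] := leP j j'.
    by have [?|?] := H _ z _ z' jj'; [apply: Or31|apply: Or33].
  have [?|?] := H _ z' _ z j'j; first exact: Or32.
  by apply: Or33; rewrite setIC.
- move=> j; split.
  + apply/seteqP; split=> // x _; exists (cube_at b j x); last exact: mem_cube_at.
    by split=> //; exists j, (gidx b j x).
  + move=> _ _ [[j1 [z1 ->]] /exp2z_inj ->] [[j2 [z2 ->]] /exp2z_inj ->].
    by move=> [x [/in_gcube <- /in_gcube <-]].
  + by move=> _ [[j1 [z1 ->]] _]; exact: gcube_nonempty.
Qed.

Lemma abs_shift b j l : (`|shift b j l| = 1 / 3)%R.
Proof.
have [] : ((-1 : R) ^ j = 1 \/ (-1 : R) ^ j = -1)%R by exact: exprN1z.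
- by rewrite /shift => ->; case: (b l); rewrite ?expr0 ?expr1 ?mulr1 ?mul1r ?mulN1r ?normrN ger0_norm//; lra.
- by rewrite /shift => ->; case: (b l); rewrite ?expr0 ?expr1 ?mulrN1 ?opprK ?mulN1r ?mul1r ?normrN ger0_norm//; lra.
Qed.

(** After rescaling by the side, the face points are integers shifted by [1 / 3] in absolute value,
    hence at distance at least [1 / 3] from 0. As soon as the side exceeds [3 * M], no face
    separates [x] from the origin. *)
Lemma gidx_origin b j x : exists d : nat,
  gidx b (j + d%:Z) x = gidx b (j + d%:Z) [tuple 0%R | _ < n].
Proof.
pose M : R := (\sum_(l < n) `|tnth x l|)%R.
have xM l : (`|tnth x l| <= M)%R.
  by rewrite /M (bigD1 l)//= lerDl sumr_ge0.
have j0 := exp2z_gt0 j.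
pose d := Num.truncn (3 * M / 2 ^ j)%R.
exists d.+1; set j' := (j + _)%R.
have Mj : (3 * M < 2 ^ j')%R.
  have : (3 * M / 2 ^ j < d.+1%:R)%R by apply: truncnS_gt.
  rewrite ltr_pdivrMr// => /lt_le_trans; apply.
  rewrite /j' expfzDr// [X in (X <= _)%R]mulrC ler_pM2l// -exprnP -natrX ler_nat.
  exact/ltnW/ltn_expl.
apply: eq_from_tnth => l; rewrite !tnth_mktuple mul0r add0r.
have j'0 := exp2z_gt0 j'.
have xj : (`|tnth x l / 2 ^ j'| < 1 / 3)%R.
  rewrite normrM normfV (gtr0_norm j'0) ltr_pdivrMr//.
  by have := xM l; lra.
have sE := abs_shift b j' l.
apply/floor_eq_ge => N.
set u := (tnth x l / 2 ^ j')%R in xj *; set s := shift _ _ _ in sE *.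
have [sE'|sE'] : (s = 1/3 \/ s = -1/3)%R.
  by move: sE; case: (ger0P s) => ? ?; [left|right]; lra.
- move: xj; rewrite ltr_norml => /andP[u1 u2].
  (* Here both [u - s] and [- s] lie strictly between -1 and 0; for the other sign of [s] they lie
     strictly between 0 and 1. *)
  have [N0|N0] := leP N (-1)%R.
    have : (N%:~R <= -1 :> R)%R by rewrite -(ler_int R) in N0; rewrite mulrN1z in N0.
    by move=> ?; apply/idP/idP => ?; lra.
  have : (0 <= N%:~R :> R)%R by rewrite ler0z; lia.
  by move=> ?; apply/idP/idP => ?; lra.
- move: xj; rewrite ltr_norml => /andP[u1 u2].
  have [N0|N0] := leP N 0%R.
    have : (N%:~R <= 0 :> R)%R by rewrite lerz0.
    by move=> ?; apply/idP/idP => _; lra.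
  have : (1 <= N%:~R :> R)%R by rewrite ler1z; lia.
  by move=> ?; apply/idP/idP => ?; lra.
Qed.

(** In each coordinate the two signs put the faces at [1 / 3] and [2 / 3] modulo 1, in units of the
    side. An interval of length at most [1 / 3] cannot have both kinds in its interior, and the sign
    is chosen separately in each coordinate. *)
Lemma grid_cover (Q : n.-tuple R * R) j :
  (side Q <= 2 ^ j / 3)%R -> exists b z, cube_set Q `<=` cube_set (gcube b j z).
Proof.
move=> Qj; have j0 := exp2z_gt0 j.
have H l : exists (e : bool) (N : int), forall t : R,
    (corner Q l <= t < corner Q l + side Q)%R ->
    Num.floor (t / 2 ^ j - (-1) ^+ e * (-1) ^ j / 3)%R = N.
  pose u := (corner Q l / 2 ^ j)%R; pose h := (side Q / 2 ^ j)%R.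
  have h3 : (h <= 1/3)%R by rewrite ler_pdivrMr//; lra.
  suff [e [N eN]] : exists (e : bool) (N : int), forall v : R,
    (u <= v < u + h)%R -> Num.floor (v - (-1) ^+ e / 3)%R = N.
    have [j1|j1] := exprN1z R j.
      exists e, N => t /andP[t1 t2]; rewrite j1 mulr1 eN//.
      by rewrite /u /h -mulrDl ler_pdivrMr// mulfVK ?gt_eqF// t1 ltr_pM2r ?invr_gt0.
    (* For odd [j] the factor [(-1) ^ j] of the shift is absorbed by flipping the sign. *)
    exists (~~ e), N => t /andP[t1 t2].
    rewrite j1 (_ : (-1) ^+ (~~ e) * -1 = (-1) ^+ e)%R; last first.
      by case: e {eN}; rewrite ?expr0 ?expr1; ring.
    rewrite eN//.
    by rewrite /u /h -mulrDl ler_pdivrMr// mulfVK ?gt_eqF// t1 ltr_pM2r ?invr_gt0.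
  (* The next face for the positive sign is at [a + 4 / 3]. If the interval reaches beyond it, then
     it lies between [a + 1] and [a + 5 / 3], where the negative sign has no face. *)
  pose a := Num.floor (u - 1 / 3)%R.
  have /andP[a1 a2] : (a%:~R <= u - 1 / 3 < (a + 1)%:~R)%R.
    by rewrite floor_le floorD1_gt.
  rewrite intrD in a2.
  have [c|c] := leP (u + h - 1 / 3)%R (a%:~R + 1)%R.
    exists false, a => v /andP[v1 v2]; apply/eqP; rewrite floor_eq intrD expr0.
    by apply/andP; split; lra.
  exists true, (a + 1)%R => v /andP[v1 v2]; apply/eqP; rewrite floor_eq !intrD expr1.
  by apply/andP; split; lra.
have [e He] := choice H.
have [N HN] := choice He.
exists [ffun l => e l], [tuple N l | l < n] => x Qx; apply/in_gcube.
apply: eq_from_tnth => l; rewrite !tnth_mktuple /shift ffunE.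
by apply: HN; exact: Qx.
Qed.

End shifted_grid.

(** * Sums, unions and integrals over countable and disjoint families *)

Section esum_complements.
Context {R : realType} {T : choiceType}.
Implicit Types (A : set T) (a : T -> \bar R).

Lemma esum_scale_le A a (c : R) : (0 <= c)%R -> (forall t, A t -> 0 <= a t) ->
  \esum_(t in A) (c%:E * a t) <= c%:E * \esum_(t in A) a t.
Proof.
move=> c0 a0; apply: ge_ereal_sup => _ [Y [fY YA] <-].
apply: (@le_trans _ _ (c%:E * \sum_(t \in Y) a t)).
  rewrite !fsbig_finite//= big_seq [X in _ * X]big_seq ge0_sume_distrr// => t.
  by rewrite in_fset_set// => /set_mem/YA/a0.
by apply: lee_wpmul2l; rewrite ?lee_fin//; apply: esum_ge; exists Y.
Qed.

Lemma esum_card_le A a (c : \bar R) (N : nat) : 0 <= c ->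
  (forall t, A t -> a t <= c) ->
  (forall s : seq T, uniq s -> (forall t, t \in s -> A t) -> (size s <= N)%N) ->
  \esum_(t in A) a t <= N%:R%:E * c.
Proof.
move=> c0 ac sN; apply: ge_ereal_sup => _ [Y [fY YA] <-].
have YE t : t \in fset_set Y -> A t by rewrite in_fset_set// => /set_mem/YA.
rewrite fsbig_finite//=.
apply: (@le_trans _ _ (\sum_(t <- fset_set Y) c)).
  by rewrite big_seq [leRHS]big_seq; apply: lee_sum => t /YE/ac.
have -> : \sum_(t <- fset_set Y) c = (size (fset_set Y))%:R%:E * c.
  elim: (enum_fset _) => [|t s IH]; first by rewrite big_nil mul0e.
  by rewrite big_cons IH/= -add1n natrD EFinD ge0_muleDl ?mul1e// lee_fin.
apply: lee_wpmul2r => //; rewrite lee_fin ler_nat; apply: sN => //.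
Qed.

Lemma esum_subset A B a b : A `<=` B -> (forall t, A t -> a t = b t) ->
  \esum_(t in A) a t <= \esum_(t in B) b t.
Proof.
move=> AB ab; apply: ge_ereal_sup => _ [Y [fY YA] <-].
apply: esum_ge; exists Y; first by split=> //; exact: subset_trans AB.
by rewrite le_eqVlt; apply/orP; left; apply/eqP/eq_fsbigr => t /set_mem/YA/ab.
Qed.

End esum_complements.

(** Turns a sum over [A] into a series over natural numbers, for which monotone convergence is
    available. The set [P] allows finite [A], and [t0] is the value of [e] outside [P]. *)
Lemma countable_enum (T : choiceType) (A : set T) (t0 : T) : countable A ->
  exists (P : set nat) (e : nat -> T), set_bij P A e.
Proof.
move=> /countable_injP[f finj].
have H k : exists t, (exists2 u, A u & f u = k) -> A t /\ f t = k.
  have [[u Au fu]|h] := pselect (exists2 u, A u & f u = k); first by exists u.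
  by exists t0.
have [e He] := choice H.
exists (f @` A), e; split.
- by move=> k /He[].
- move=> k k' /set_mem /He[_ {2}<-] /set_mem /He[_ {2}<-] ->; by [].
- move=> t At; exists (f t); first by exists t.
  have [Ae fe] := He (f t) (ex_intro2 _ _ t At erefl).
  by apply: finj fe; exact: mem_set.
Qed.

Section countable_families.
Context d (X : measurableType d) (R : realType) (mu : {measure set X -> \bar R}).
Context (T : choiceType) (A : set T).
Hypothesis cA : countable A.

Lemma measurable_esum (g : T -> X -> \bar R) :
  (forall t x, 0 <= g t x) -> (forall t, A t -> measurable_fun setT (g t)) ->
  measurable_fun setT (fun x => \esum_(t in A) g t x).
Proof.
move=> g0 mg; have [->|/set0P[t0 _]] := eqVneq A set0.
  by under eq_fun do rewrite esum_set0; exact: measurable_cst.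
have [P [e bij]] := countable_enum t0 cA.
have [eA einj eA'] := bij.
have E x : \esum_(t in A) g t x = \sum_(k <oo | k \in P) g (e k) x.
  by rewrite (reindex_esum P A e _ bij) -[in LHS](set_mem_set P) -nneseries_esum.
under eq_fun do rewrite E.
apply: ge0_emeasurable_sum => // k /set_mem Pk; apply: mg; exact: eA.
Qed.

Lemma integral_esum (g : T -> X -> \bar R) :
  (forall t x, 0 <= g t x) -> (forall t, A t -> measurable_fun setT (g t)) ->
  \int[mu]_x (\esum_(t in A) g t x) = \esum_(t in A) \int[mu]_x g t x.
Proof.
move=> g0 mg; have [->|/set0P[t0 _]] := eqVneq A set0.
  by under eq_integral do rewrite esum_set0; rewrite integral0 esum_set0.
have [P [e bij]] := countable_enum t0 cA.
have [eA einj eA'] := bij.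
have E x : \esum_(t in A) g t x = \sum_(k <oo) (if k \in P then g (e k) x else 0).
  by rewrite (reindex_esum P A e _ bij) -[in LHS](set_mem_set P) -nneseries_esum// eseries_mkcond.
under eq_integral do rewrite E.
rewrite integral_nneseries//; last 2 first.
- move=> k; have [Pk|_] := boolP (k \in P); last exact: measurable_cst.
  by apply: mg; apply: eA; exact: set_mem.
- by move=> k x _; case: ifPn.
rewrite [RHS](reindex_esum P A e _ bij) -[in RHS](set_mem_set P) -nneseries_esum//; last first.
  by move=> k _; apply: integral_ge0.
rewrite [RHS]eseries_mkcond; apply: eq_eseriesr => k _.
by case: ifPn => // _; rewrite integral0.
Qed.

Lemma measurable_countable_bigcup (F : T -> set X) :
  (forall t, A t -> measurable (F t)) -> measurable (\bigcup_(t in A) F t).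
Proof.
move=> mF; have [->|/set0P[t0 _]] := eqVneq A set0; first by rewrite bigcup_set0.
have [P [e [eA _ eA']]] := countable_enum t0 cA.
have -> : \bigcup_(t in A) F t = \bigcup_(k in P) F (e k).
  apply/seteqP; split=> [x [t /eA'[k Pk <-] Fx]|x [k Pk Fx]]; first by exists k.
  by exists (e k) => //; exact: eA.
by apply: bigcup_measurable => k Pk; apply: mF; exact: eA.
Qed.

Lemma measure_countable_subadditive (F : T -> set X) :
  (forall t, A t -> measurable (F t)) ->
  mu (\bigcup_(t in A) F t) <= \esum_(t in A) mu (F t).
Proof.
move=> mF; have [->|/set0P[t0 _]] := eqVneq A set0.
  by rewrite esum_set0 bigcup_set0 measure0.
have [P [e bij]] := countable_enum t0 cA.
have [eA einj eA'] := bij.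
pose G k := if k \in P then F (e k) else set0.
rewrite (reindex_esum P A e _ bij) -[P](set_mem_set P) -nneseries_esum// eseries_mkcond.
have -> : \bigcup_(t in A) F t = \bigcup_k G k.
  apply/seteqP; split=> [x [t /eA'[k Pk <-] Fx]|x [k _]].
    by exists k => //; rewrite /G mem_set.
  by rewrite /G; case: ifPn => // /set_mem Pk ?; exists (e k) => //; exact: eA.
have mG k : measurable (G k).
  by rewrite /G; case: ifPn => // /set_mem Pk; apply: mF; exact: eA.
have -> : \sum_(k <oo) (if k \in P then mu (F (e k)) else 0) = \sum_(k <oo) mu (G k).
  by apply: eq_eseriesr => k _; rewrite /G; case: ifPn; rewrite ?measure0.
apply: measure_sigma_subadditive => //.
exact: bigcup_measurable.
Qed.

End countable_families.

Section disjoint_families.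
Context d (X : measurableType d) (R : realType) (mu : {measure set X -> \bar R}).
Context (T : choiceType).

Lemma integral_disjoint_superadditive (A : set T) (F : T -> set X) (B : set X)
    (g : X -> \bar R) :
  (forall t, A t -> measurable (F t)) -> measurable B -> trivIset A F ->
  (forall t, A t -> F t `<=` B) ->
  measurable_fun setT g -> (forall x, 0 <= g x) ->
  \esum_(t in A) \int[mu]_(x in F t) g x <= \int[mu]_(x in B) g x.
Proof.
move=> mF mB tF FB mg g0; apply: ge_ereal_sup => _ [Y [fY YA] <-].
rewrite fsbig_finite//=.
(* Replacing [F] by the empty set outside [Y] makes every member of the family measurable, as
   additivity over a finite union asks. *)
pose F' t := if t \in Y then F t else set0.
have YE t : (t \in fset_set Y) -> Y t by rewrite in_fset_set// => /set_mem.
rewrite (eq_big_seq (fun t => \int[mu]_(x in F' t) g x)); last first.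
  by move=> t; rewrite in_fset_set// /F' => ->.
have mF' t : measurable (F' t).
  by rewrite /F'; case: ifPn => // /set_mem/YA/mF.
rewrite -ge0_integral_bigsetU//.
- apply: ge0_subset_integral => //.
  + by apply: bigsetU_measurable.
  + exact: measurable_funS mg.
  + move=> x; rewrite -bigcup_seq => -[t /= tY].
    by rewrite /F'; case: ifPn => // /set_mem /YA /FB; apply.
- move=> t t' /= tY t'Y; rewrite /F' !mem_set; [|exact: YE..].
  by apply: tF; apply: YA; exact: YE.
- exact: measurable_funS mg.
Qed.

Lemma measure_disjoint_superadditive (A : set T) (F : T -> set X) (B : set X) :
  (forall t, A t -> measurable (F t)) -> measurable B -> trivIset A F ->
  (forall t, A t -> F t `<=` B) ->
  \esum_(t in A) mu (F t) <= mu B.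
Proof.
move=> mF mB tF FB; have := @integral_disjoint_superadditive A F B (cst 1) mF mB tF FB.
rewrite integral_cst// mul1e => /(_ (measurable_cst _) (fun=> lee01)).
by apply: le_trans; apply: le_esum => t At; rewrite integral_cst ?mul1e//; exact: mF.
Qed.

End disjoint_families.

(** * Combinatorics of an arbitrary dyadic grid *)

Section dyadic.
Context {R : realType} {n : nat}.
Hypothesis n_gt0 : (0 < n)%N.
Variable D : set (n.-tuple R * R).
Hypothesis gD : dyadic_grid D.
Implicit Types Q : n.-tuple R * R.

Lemma dyadic_side_gt0 Q : D Q -> (0 < side Q)%R.
Proof. by have [h _ _] := gD => /h[j ->]; exact: exp2z_gt0. Qed.

Lemma dyadic_same_side Q Q' x : D Q -> D Q' -> side Q = side Q' ->
  cube_set Q x -> cube_set Q' x -> Q = Q'.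
Proof.
have [h _ p] := gD => DQ DQ' s Qx Q'x; have [j sj] := h _ DQ.
have [_ t _] := p j; apply: t => //; last by exists x.
- by split => //; rewrite -s.
Qed.

Lemma leb_dyadic Q : D Q -> leb R n (cube_set Q) = (side Q ^+ n)%:E.
Proof. by move=> /dyadic_side_gt0/ltW/leb_cube. Qed.

(** The common point excludes disjointness. In the reverse inclusion, comparing measures forces
    equal sides, and two cubes of one generation with a common point coincide. *)
Lemma dyadic_subset Q Q' x : D Q -> D Q' -> (side Q <= side Q')%R ->
  cube_set Q x -> cube_set Q' x -> cube_set Q `<=` cube_set Q'.
Proof.
have [_ h _] := gD => DQ DQ' s Qx Q'x; have [//|Q'Q|QQ'] := h _ _ DQ DQ'.
  suff sE : side Q = side Q' by rewrite (dyadic_same_side DQ DQ' sE Qx Q'x).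
  have : leb R n (cube_set Q') <= leb R n (cube_set Q).
    by apply: le_leb => //; exact: measurable_cube.
  rewrite !leb_dyadic// lee_fin ler_pXn2r ?nnegrE ?(ltW (dyadic_side_gt0 _))// => s'.
  by apply/le_anti; rewrite s s'.
by have : (cube_set Q `&` cube_set Q') x by []; rewrite QQ'.
Qed.

(** A cube is coded by its scale and the integer parts of its corner in units of the side. Cubes
    with the same code have corners less than one side apart in each coordinate, so they meet and
    are equal. *)
Lemma countable_dyadic : countable D.
Proof.
have [h _ _] := gD.
have H Q : exists j : int, D Q -> side Q = (2 ^ j)%R.
  by have [/h[j ?]|nD] := pselect (D Q); [exists j|exists 0%R].
have [j Hj] := choice H.
pose f Q := choice.pickle (j Q, [tuple Num.floor (corner Q i / side Q)%R | i < n]).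
apply/countable_injP; exists f => Q Q' /set_mem DQ /set_mem DQ' /(pcan_inj choice.pickleK) ff.
have jj : j Q = j Q' := congr1 fst ff.
move/(congr1 snd): ff => /= ff.
have s : side Q = side Q' by rewrite !Hj// jj.
have sQ := dyadic_side_gt0 DQ.
have cl i : (corner Q i < corner Q' i + side Q /\ corner Q' i < corner Q i + side Q)%R.
  have /(congr1 (fun t => tnth t i)) := ff; rewrite !tnth_mktuple => fl.
  have := floor_itv (corner Q i / side Q)%R; have := floor_itv (corner Q' i / side Q')%R.
  rewrite -fl -s intrD => /andP[a1 a2] /andP[b1 b2].
  have ab : (corner Q i / side Q < corner Q' i / side Q + 1)%R by lra.
  have ba : (corner Q' i / side Q < corner Q i / side Q + 1)%R by lra.
  rewrite ltr_pdivrMr// mulrDl mulfVK ?gt_eqF// mul1r in ab.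
  by rewrite ltr_pdivrMr// mulrDl mulfVK ?gt_eqF// mul1r in ba.
(* The coordinatewise maximum of the two corners is a common point. *)
apply: (@dyadic_same_side Q Q' [tuple Num.max (corner Q i) (corner Q' i) | i < n]) => // i;
  rewrite tnth_mktuple -?s; have [c1 c2] := cl i; rewrite le_max lexx ?orbT gt_max.
  by rewrite c2 ltrDl sQ.
by rewrite c1 ltrDl sQ.
Qed.

(** Sides are powers of two bounded by [M], so only finitely many sizes occur above a given cube and
    a largest one exists. Maximal cubes that meet are nested, hence equal. *)
Lemma dyadic_maximal (G : set (n.-tuple R * R)) (M : R) : G `<=` D ->
  (forall Q, G Q -> side Q <= M)%R ->
  exists H, [/\ H `<=` G, trivIset H cube_set &
    forall Q, G Q -> exists Q', [/\ H Q', cube_set Q `<=` cube_set Q' & (side Q <= side Q')%R]].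
Proof.
move=> GD GM; have [h _ _] := gD.
exists [set Q | G Q /\ forall Q', G Q' -> cube_set Q `<=` cube_set Q' -> (side Q' <= side Q)%R].
split=> [Q [//]|Q Q' [GQ mQ] [GQ' mQ'] [x [Qx Q'x]]|Q GQ].
  have [DQ DQ'] := (GD _ GQ, GD _ GQ').
  apply: (dyadic_same_side DQ DQ' _ Qx Q'x); apply/le_anti/andP; split.
    have /orP[//|s] := le_total (side Q) (side Q').
    by apply: mQ' => //; exact: (dyadic_subset DQ' DQ s Q'x Qx).
  have /orP[//|s] := le_total (side Q') (side Q).
  by apply: mQ => //; exact: (dyadic_subset DQ DQ' s Qx Q'x).
have [j sQ] := h _ (GD _ GQ).
pose P (d : nat) := `[< exists2 Q', G Q' /\ cube_set Q `<=` cube_set Q' & side Q' = (2 ^ (j + d%:Z))%R >].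
have P0 : exists d, P d by exists 0%N; apply/asboolP; exists Q; [by split|rewrite addr0].
have Pb d : P d -> (d <= Num.truncn (M / 2 ^ j))%N.
  move=> /asboolP[Q' [GQ' _] s]; have := GM _ GQ'; rewrite s expfzDr// => le.
  have j0 := @exp2z_gt0 R j.
  rewrite -ltnS -(ltr_nat R); apply: le_lt_trans (truncnS_gt _).
  rewrite ler_pdivlMr// mulrC; apply: le_trans le; rewrite ler_pM2l//.
  by rewrite -exprnP -natrX ler_nat ltnW// ltn_expl.
have [d /asboolP[Q' [GQ' QQ'] s'] dmax] := ex_maxnP P0 Pb.
have QQ : (side Q <= side Q')%R.
  by rewrite s' sQ ler_eXz2l ?ltr1n//; lia.
exists Q'; split=> //; split=> // Q2 GQ2 Q'Q2.
have [//|lt] := leP (side Q2) (side Q').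
have [j2 s2] := h _ (GD _ GQ2).
have jj2 : (j <= j2)%R by rewrite -(@ler_eXz2l R 2) ?ltr1n// -s2 -sQ (le_trans QQ)// ltW.
have /dmax dd : P `|j2 - j|%N.
  apply/asboolP; exists Q2; first by split=> //; exact: subset_trans Q'Q2.
  by rewrite s2; congr (_ ^ _)%R; lia.
by move: lt; rewrite s' s2 ltr_eXz2l ?ltr1n//; lia.
Qed.

End dyadic.

(** * Means, the dyadic maximal function and the Carleson property *)

Section covering.
Context {R : realType} {n : nat}.
Hypothesis n_gt0 : (0 < n)%N.
Implicit Types Q : n.-tuple R * R.

(** With [g] the power [p0] of the absolute value of [f], this is [average p0 f] before the root is
    taken; the weak type estimate applies to it directly. *)
Definition mean (g : eucl R n -> \bar R) Q : \bar R :=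
  (leb R n (cube_set Q))^-1 * \int[leb R n]_(x in cube_set Q) g x.

Lemma mean_ge0 g Q : (forall x, 0 <= g x) -> 0 <= mean g Q.
Proof. by move=> g0; rewrite mule_ge0 ?inve_ge0// integral_ge0. Qed.

Lemma meanE g Q : (0 < side Q)%R ->
  mean g Q = ((side Q ^+ n)^-1)%:E * \int[leb R n]_(x in cube_set Q) g x.
Proof.
by move=> Q0; rewrite /mean leb_cube ?ltW// inver gt_eqF// exprn_gt0.
Qed.

Lemma integral_mean g Q : (0 < side Q)%R ->
  \int[leb R n]_(x in cube_set Q) g x = (side Q ^+ n)%:E * mean g Q.
Proof.
move=> Q0; rewrite meanE// muleA -EFinM divff ?mul1e//.
by rewrite gt_eqF// exprn_gt0.
Qed.

Lemma cube_subset_side Q Q' : (0 <= side Q)%R -> (0 <= side Q')%R ->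
  cube_set Q `<=` cube_set Q' -> (side Q <= side Q')%R.
Proof.
move=> Q0 Q'0 /le_leb => /(_ (measurable_cube _) (measurable_cube _)).
by rewrite !leb_cube// lee_fin ler_pXn2r.
Qed.

Lemma mean_subset g Q Q' (c : R) : measurable_fun setT g -> (forall x, 0 <= g x) ->
  (0 < side Q)%R -> (0 < side Q')%R -> (side Q' <= c * side Q)%R ->
  cube_set Q `<=` cube_set Q' -> mean g Q <= (c ^+ n)%:E * mean g Q'.
Proof.
move=> mg g0 Q0 Q'0 s QQ'; rewrite !meanE// muleA -EFinM.
have I0 : 0 <= \int[leb R n]_(x in cube_set Q) g x by apply: integral_ge0.
apply: (@le_trans _ _ ((c ^+ n / side Q' ^+ n)%:E * \int[leb R n]_(x in cube_set Q) g x)).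
  apply: lee_wpmul2r => //; rewrite lee_fin -expr_div_n -exprVn.
  apply: lerXn2r; rewrite ?nnegrE ?invr_ge0 ?(ltW Q0)//.
    rewrite divr_ge0 ?(ltW Q'0)// -(@pmulr_lge0 _ (side Q))//.
    exact: le_trans (ltW Q'0) s.
  by rewrite ler_pdivlMr// ler_pdivrMl// mulrC.
apply: lee_wpmul2l.
  rewrite lee_fin divr_ge0 ?exprn_ge0 ?(ltW Q'0)// -(@pmulr_lge0 _ (side Q))//.
  exact: le_trans (ltW Q'0) s.
apply: ge0_subset_integral => //; [exact: measurable_cube..|].
exact: measurable_funS mg.
Qed.

Variable D : set (n.-tuple R * R).
Hypothesis gD : dyadic_grid D.

Lemma measurable_cubes (G : set (n.-tuple R * R)) : G `<=` D ->
  measurable (\bigcup_(Q in G) cube_set Q : set (eucl R n)).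
Proof.
move=> GD; apply: measurable_countable_bigcup.
  exact: sub_countable (subset_card_le GD) (countable_dyadic gD).
by move=> Q _; exact: measurable_cube.
Qed.

(** The weak type (1,1) inequality for the dyadic maximal function, localized to [Q0]: sum over the
    disjoint maximal cubes on which the mean is large. *)
Lemma dyadic_maximal_le g (Q0 : n.-tuple R * R) (c : R) :
  measurable_fun setT g -> (forall x, 0 <= g x) -> (0 < side Q0)%R -> (0 < c)%R ->
  leb R n (\bigcup_(Q in [set Q | [/\ D Q, cube_set Q `<=` cube_set Q0 &
      c%:E * mean g Q0 < mean g Q]]) cube_set Q) <=
    (c^-1)%:E * leb R n (cube_set Q0).
Proof.
move=> mg g0 Q00 c0; set G := [set Q | _].
have GD : G `<=` D by move=> Q [].
have [->|/set0P[Q1 [DQ1 Q10 lt1]]] := eqVneq G set0.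
  by rewrite bigcup_set0 measure0 mule_ge0// lee_fin invr_ge0 ltW.
(* Since some cube belongs to [G], the mean over [Q0] is neither 0, which would make the means over
   subcubes vanish, nor infinite, which none could exceed. *)
have [r r0 rE] : exists2 r, (0 < r)%R & mean g Q0 = r%:E.
  case E : (mean g Q0) => [r| |].
  - exists r => //; rewrite lt_neqAle -lee_fin -E mean_ge0// andbT.
    apply/eqP => rE; move: lt1; rewrite E -rE mule0.
    rewrite ltNge => /negP; apply.
    have -> : 0 = ((side Q0 / side Q1) ^+ n)%:E * mean g Q0 by rewrite E -rE mule0.
    have ? := dyadic_side_gt0 gD DQ1.
    by apply: mean_subset => //; rewrite mulfVK// gt_eqF.
  - by move: lt1; rewrite E gt0_muley ?lte_fin// ltNge leey.
  - by have := mean_ge0 Q0 g0; rewrite E.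
have [H [HG tH GH]] : exists H, [/\ H `<=` G, trivIset H cube_set &
    forall Q, G Q -> exists Q', [/\ H Q', cube_set Q `<=` cube_set Q' & (side Q <= side Q')%R]].
  apply: (dyadic_maximal n_gt0 gD GD (M := side Q0)) => Q [/(dyadic_side_gt0 gD)/ltW DQ QQ0 _].
  by apply: cube_subset_side => //; exact: ltW.
have -> : \bigcup_(Q in G) cube_set Q = \bigcup_(Q in H) cube_set Q.
  apply/seteqP; split=> x [Q GQ Qx]; last by exists Q => //; exact: HG.
  by have [Q' [HQ' QQ' _]] := GH _ GQ; exists Q' => //; exact: QQ'.
have HD : H `<=` D by exact: subset_trans GD.
apply: le_trans (measure_countable_subadditive _ _ _) _.
- exact: sub_countable (subset_card_le HD) (countable_dyadic gD).
- by move=> Q _; exact: measurable_cube.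
have cr0 : (0 <= (c * r)^-1)%R by rewrite invr_ge0 mulr_ge0 ?ltW.
have mcg : measurable_fun setT (fun x => ((c * r)^-1)%:E * g x).
  by apply: measurable_funeM.
(* The function [g / (c * r)] has mean above 1 on each cube of [H], so its integral there bounds the
   measure of the cube. *)
apply: (@le_trans _ _ (\esum_(Q in H) \int[leb R n]_(x in cube_set Q) (((c * r)^-1)%:E * g x))).
  apply: le_esum => Q /HG[DQ _ lt].
  have Qs := dyadic_side_gt0 gD DQ.
  rewrite ge0_integralZl_EFin//; last 2 first.
  - exact: measurable_cube.
  - exact: measurable_funS mg.
  rewrite integral_mean// muleCA leb_cube ?(ltW Qs)// -[leLHS]mule1.
  apply: lee_wpmul2l; first by rewrite lee_fin exprn_ge0// ltW.
  rewrite -(@lee_pmul2l _ (c * r)%:E) ?lte_fin ?mulr_gt0// mule1 muleA -EFinM divff ?gt_eqF ?mulr_gt0//.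
  by rewrite mul1e EFinM -rE ltW.
apply: le_trans.
  apply: integral_disjoint_superadditive => //.
  - by move=> Q _; exact: measurable_cube.
  - exact: (measurable_cube Q0).
  - by move=> Q /HG[].
  - by move=> x; rewrite mule_ge0.
rewrite ge0_integralZl_EFin//; last 2 first.
- exact: measurable_cube.
- exact: measurable_funS mg.
rewrite integral_mean// rE leb_cube ?(ltW Q00)// -!EFinM lee_fin.
rewrite le_eqVlt; apply/orP; left; apply/eqP; field.
by rewrite !lt0r_neq0.
Qed.

(** [V] is the union of the triples of the maximal cubes of [G]. It serves for cubes of another grid
    that meet a cube of [G] without being nested in it. *)
Lemma near_cover (G : set (n.-tuple R * R)) (M : R) : G `<=` D ->
  (forall Q, G Q -> side Q <= M)%R ->
  exists V : set (eucl R n), [/\ measurable V,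
    (forall Q x y, G Q -> cube_set Q x ->
       (forall l : 'I_n, `|tnth y l - tnth x l| < side Q)%R -> V y) &
    leb R n V <= (3 ^+ n)%:E * leb R n (\bigcup_(Q in G) cube_set Q)].
Proof.
move=> GD GM; have [H [HG tH GH]] := dyadic_maximal n_gt0 gD GD GM.
pose triple Q : n.-tuple R * R := ([tuple (corner Q l - side Q)%R | l < n], (3 * side Q)%R).
have HD : H `<=` D by exact: subset_trans GD.
have cH : countable H by exact: sub_countable (subset_card_le HD) (countable_dyadic gD).
exists (\bigcup_(Q in H) cube_set (triple Q)); split.
- by apply: measurable_countable_bigcup => // Q _; exact: measurable_cube.
- move=> Q x y GQ Qx xy; have [Q' [HQ' QQ' ss]] := GH _ GQ.
  exists Q' => // l; rewrite /corner /side/= tnth_mktuple.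
  have /andP[] := QQ' _ Qx l; have := xy l.
  rewrite ltr_norml /corner /side in ss * => /andP[] *.
  by apply/andP; split; lra.
apply: le_trans (measure_countable_subadditive _ _ _) _ => //.
  by move=> Q _; exact: measurable_cube.
apply: (@le_trans _ _ ((3 ^+ n)%:E * \esum_(Q in H) leb R n (cube_set Q))); last first.
  apply: lee_wpmul2l; first by rewrite lee_fin exprn_ge0.
  apply: measure_disjoint_superadditive => //.
  - by move=> Q _; exact: measurable_cube.
  - exact: measurable_cubes.
  - by move=> Q HQ x Qx; exists Q => //; exact: HG.
have c3 : (0 <= 3 ^+ n :> R)%R by exact: exprn_ge0.
apply: (@le_trans _ _ (\esum_(Q in H) ((3 ^+ n)%:E * leb R n (cube_set Q)))).
  apply: le_esum => Q /HD/(dyadic_side_gt0 gD)/ltW Qs.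
  by rewrite !leb_cube//= ?mulr_ge0// -EFinM lee_fin /side/= exprMn.
exact: esum_scale_le.
Qed.

(** Chebyshev's inequality for the overlap function of [A], whose integral is at most twice the
    total measure of the disjoint sets [E Q], all inside [Q0]. *)
Lemma sparse_overlap_le (S A : set (n.-tuple R * R)) (Q0 : n.-tuple R * R) (c : R) :
  S `<=` D -> sparse S -> A `<=` S -> (forall Q, A Q -> cube_set Q `<=` cube_set Q0) ->
  (0 < c)%R ->
  leb R n (\bigcup_(Q in [set Q | S Q /\ forall x, cube_set Q x ->
      c%:E <= \esum_(Q' in A) (\1_(cube_set Q') x)%:E]) cube_set Q) <=
    (2 / c)%:E * leb R n (cube_set Q0).
Proof.
move=> SD [E [mE EQ tE E2]] AS AQ0 c0; set G := [set Q | _].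
have GD : G `<=` D by move=> Q [/SD].
have AD : A `<=` D by exact: subset_trans SD.
have cA : countable A by exact: sub_countable (subset_card_le AD) (countable_dyadic gD).
set B := \bigcup_(Q in G) _; have mB : measurable B by exact: measurable_cubes.
have m1 Q : A Q -> measurable_fun setT (fun x : eucl R n => (\1_(cube_set Q) x : R)%:E).
  by move=> _; apply/measurable_EFinP; apply: measurable_indic; exact: measurable_cube.
have le1 : c%:E * leb R n B <= 2%:E * leb R n (cube_set Q0).
  apply: (@le_trans _ _ (\int[leb R n]_x (c%:E * (\1_B x)%:E))).
    have m1B : measurable_fun setT (fun x : eucl R n => (\1_B x : R)%:E).
      by apply/measurable_EFinP; apply: measurable_indic.
    rewrite (ge0_integralZl_EFin (leb R n) measurableT _ m1B (ltW c0)).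
      by rewrite (integral_indic _ measurableT mB) setIT.
    by move=> x _; rewrite lee_fin.
  apply: (@le_trans _ _ (\int[leb R n]_x (\esum_(Q in A) (\1_(cube_set Q) x)%:E))).
    apply: ge0_le_integral.
    - exact: measurableT.
    - by move=> x _; rewrite mule_ge0 ?lee_fin ?(ltW c0).
    - apply: measurable_funeM; apply/measurable_EFinP; exact: measurable_indic.
    - by apply: (measurable_esum cA) => [t x|]; [rewrite lee_fin|exact: m1].
    move=> x _; rewrite indicE; case: (boolP (x \in B)) => [/set_mem[Q [_ Qc] Qx]|_].
      by rewrite mule1; exact: Qc.
    by rewrite mule0; apply: esum_ge0 => Q _; rewrite lee_fin.
  rewrite (integral_esum _ cA)//.
  apply: (@le_trans _ _ (2%:E * \esum_(Q in A) leb R n (E Q))); last first.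
    apply: lee_wpmul2l; first by rewrite lee_fin.
    apply: measure_disjoint_superadditive.
    - by move=> Q /AS/mE.
    - exact: measurable_cube.
    - exact: sub_trivIset tE.
    - by move=> Q AQ; apply: subset_trans (AQ0 _ AQ); apply: EQ; exact: AS.
  apply: (@le_trans _ _ (\esum_(Q in A) (2%:E * leb R n (E Q)))); last first.
    by apply: esum_scale_le; [exact: ler0n|move=> Q _; exact: measure_ge0].
  apply: le_esum => Q /AS SQ.
  rewrite integral_indic; [|exact: measurableT|exact: measurable_cube].
  by rewrite setIT; exact: E2.
rewrite -(@lee_pmul2l _ c%:E) ?lte_fin//; apply: le_trans le1 _.
by rewrite muleA -EFinM mulrC mulfVK ?gt_eqF.
Qed.

End covering.

(** * Sparse families obtained from an abstract stopping rule *)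

Section stopping_cubes.
Context {R : realType} {n : nat}.
Variables (b : {ffun 'I_n -> bool}) (stop : n.-tuple R * R -> n.-tuple R * R -> Prop).
Implicit Types (i : int) (x y z : n.-tuple R).

(* Only every other scale is used: quad (i - 1) origin then fills at most a
   quarter of quad i origin. *)
Definition quad i x := cube_at b (2 * i)%R x.

Definition origin : n.-tuple R := [tuple 0%R | _ < n].

Lemma quad_eq i x y : cube_set (quad i x) y <-> quad i y = quad i x.
Proof.
by rewrite in_cube_at; split=> [/cube_at_eq//|yx]; apply/in_cube_at; rewrite -/(quad i x) -yx; exact: mem_cube_at.
Qed.

Lemma mem_quad i x : cube_set (quad i x) x.
Proof. exact: mem_cube_at. Qed.

Lemma quad_le i i' x y : (i <= i')%R -> quad i x = quad i y -> quad i' x = quad i' y.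
Proof.
move=> ii' /quad_eq xy; apply/quad_eq.
by apply: cube_at_sub xy; lia.
Qed.

Lemma side_quad i x : side (quad i x) = (2 ^ (2 * i))%R.
Proof. by []. Qed.

Lemma side_quad_gt0 i x : (0 < side (quad i x))%R.
Proof. exact: exp2z_gt0. Qed.

Lemma grid_quad i x : grid b (quad i x).
Proof. by exists (2 * i)%R, (gidx b (2 * i)%R x). Qed.

Lemma quad_origin i x :
  exists d : nat, quad (i + d%:Z) x == quad (i + d%:Z) origin.
Proof.
have [d dE] := gidx_origin b (2 * i)%R x; exists d; apply/eqP/cube_at_eq.
by apply: gidx_le dE; lia.
Qed.

(** The number of generations up to the first ancestor that contains the origin; it is the fuel of
    the recursion below. *)
Definition height i x := ex_minn (quad_origin i x).

Lemma height0 i x : quad i x = quad i origin -> height i x = 0%N.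
Proof.
move=> xE; rewrite /height; case: ex_minnP => d _ /(_ 0%N).
by rewrite addr0 xE eqxx leqn0 => /(_ isT)/eqP.
Qed.

Lemma heightS i x : quad i x <> quad i origin -> height i x = (height (i + 1) x).+1.
Proof.
move=> xN; rewrite /height; case: ex_minnP => -[|d] dE dmin.
  by move: dE; rewrite addr0 => /eqP.
case: ex_minnP => e eE emin; congr _.+1; apply/eqP; rewrite eqn_leq.
have eq (k : nat) : (i + k.+1%:Z = i + 1 + k%:Z)%R by lia.
apply/andP; split; last by apply: emin; rewrite -eq.
by rewrite -ltnS; apply: dmin; rewrite eq.
Qed.

(* The cubes quad i origin exhaust the space, so every cube has a first ancestor
   of this form; all of these are selected, and the other cubes are selected by
   going down from that ancestor. *)
Fixpoint ancestor_rec (d : nat) i x : int :=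
  if d is d'.+1 then
    let t := ancestor_rec d' (i + 1)%R x in
    if `[< stop (quad t x) (quad i x) >] then i else t
  else i.

(** This is the scale of the smallest selected cube containing [quad i x]. *)
Definition ancestor i x := ancestor_rec (height i x) i x.

Lemma ancestor_root i x : quad i x = quad i origin -> ancestor i x = i.
Proof. by rewrite /ancestor => /height0 ->. Qed.

Lemma ancestor_step i x : quad i x <> quad i origin ->
  ancestor i x = if `[< stop (quad (ancestor (i + 1) x) x) (quad i x) >] then i
                 else ancestor (i + 1) x.
Proof. by rewrite /ancestor => /heightS ->. Qed.

Lemma ancestor_rec_ge d i x : (i <= ancestor_rec d i x)%R.
Proof.
elim: d i => //= d IH i; case: ifP => // _.
by have := IH (i + 1)%R; lia.
Qed.

Lemma ancestor_ge i x : (i <= ancestor i x)%R.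
Proof. exact: ancestor_rec_ge. Qed.

(** Makes being selected a property of the cube and not of the point that represents it. *)
Lemma ancestor_quad i x y : quad i x = quad i y -> ancestor i x = ancestor i y.
Proof.
move=> xy; rewrite /ancestor.
have -> : height i x = height i y.
  by rewrite /height; apply: eq_ex_minn => d; rewrite (quad_le _ xy)//; lia.
move: (height i y) => d; elim: d i xy => //= d IH i xy.
have xy1 : quad (i + 1) x = quad (i + 1) y by apply: quad_le xy; lia.
rewrite (IH _ xy1) xy (quad_le _ xy)//.
by have := ancestor_rec_ge d (i + 1)%R y; lia.
Qed.

Lemma ancestor_idem i x : ancestor (ancestor i x) x = ancestor i x.
Proof.
move dE : (height i x) => d; elim: d i dE => [|d IH] i dE.
  by rewrite {2 3}/ancestor dE/= {1}/ancestor dE.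
have [/height0|xN] := pselect (quad i x = quad i origin); first by rewrite dE.
have := heightS xN; rewrite dE => -[/esym/IH idem].
rewrite (ancestor_step xN); case: ifPn => // s.
by rewrite (ancestor_step xN) s.
Qed.

(** Source of both estimates used within one grid: the comparison of means and the count of cubes
    with a common ancestor. *)
Lemma ancestor_nostop i x : ancestor i x <> i ->
  ~ stop (quad (ancestor i x) x) (quad i x).
Proof.
move=> aN; have [/ancestor_root//|xN] := pselect (quad i x = quad i origin).
by move: aN; rewrite (ancestor_step xN); case: ifPn => // /asboolPn.
Qed.

(** By induction on the number of generations below [i0]: a cube can become selected only by
    containing the origin or by stopping. *)
Lemma ancestor_below i0 i x : ancestor i0 x = i0 -> (i <= i0)%R ->
  (forall i', (i <= i' < i0)%R -> quad i' x <> quad i' origin /\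
     ~ stop (quad i0 x) (quad i' x)) -> ancestor i x = i0.
Proof.
move=> a0 ii0; have -> : i = (i0 - `|i0 - i|%N%:Z)%R by lia.
elim: `|i0 - i|%N => [|d IH] h; first by rewrite subr0.
have [] := h (i0 - d.+1%:Z)%R; first lia.
move=> xN sN; rewrite (ancestor_step xN).
have -> : (i0 - d.+1%:Z + 1 = i0 - d%:Z)%R by lia.
rewrite IH; last by move=> i' i'P; apply: h; lia.
by case: ifPn => // /asboolP.
Qed.

Definition selected : set (n.-tuple R * R) :=
  [set Q | exists i x, Q = quad i x /\ ancestor i x = i].

Lemma selected_grid : selected `<=` grid b.
Proof. by move=> _ [i [x [-> _]]]; exact: grid_quad. Qed.

Hypothesis n_gt0 : (0 < n)%N.
(** One quarter is left to the stopping cubes and another to the cube of the previous scale around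
    the origin, so half of each selected cube survives. *)
Hypothesis stop_small : forall i x, exists V : set (eucl R n),
  [/\ measurable V,
      forall i' z, (i' < i)%R -> cube_set (quad i x) z ->
        stop (quad i x) (quad i' z) -> V z &
      leb R n V <= (4^-1)%:E * leb R n (cube_set (quad i x))].

(** From each selected cube all smaller selected cubes are removed, wherever they are, so
    disjointness follows by comparing sides. What is removed inside the cube lies in [V] or in
    [O]. *)
Lemma sparse_selected : sparse selected.
Proof.
pose small (Q : n.-tuple R * R) := [set Q' | selected Q' /\ (side Q' < side Q)%R].
pose U (Q : n.-tuple R * R) : set (eucl R n) := \bigcup_(Q' in small Q) cube_set Q'.
have mU Q : measurable (U Q).
  by apply: (measurable_cubes (grid_dyadic b)) => Q' [/selected_grid].
exists (fun Q => cube_set Q `\` U Q); split.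
- by move=> Q _; apply: measurableD => //; exact: measurable_cube.
- by move=> Q _ x [].
- move=> Q Q' sQ sQ' [x [[Qx UQ] [Q'x UQ']]].
  have [s|s|s] := ltgtP (side Q) (side Q').
  + by case: UQ'; exists Q.
  + by case: UQ; exists Q'.
  + exact: (dyadic_same_side (grid_dyadic b) (selected_grid sQ) (selected_grid sQ') s Qx Q'x).
move=> _ [i [x [-> ai]]]; have [V [mV stopV leV]] := stop_small i x.
set Q := quad i x; pose O := cube_set (quad (i - 1) origin) : set (eucl R n).
have mO : measurable O by exact: measurable_cube.
have mE : measurable (cube_set Q `\` U Q).
  by apply: measurableD => //; exact: measurable_cube.
have QU : cube_set Q `<=` (cube_set Q `\` U Q) `|` (V `|` O).
  move=> z Qz; have [[Q' [[i' [x' [Q'E ai']]] s] Q'z]|nU] := pselect (U Q z); last by left.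
  right; move: s; rewrite Q'E !side_quad ltr_eXz2l ?ltr1n// => s.
  have zx : quad i z = quad i x by exact/quad_eq.
  have zx' : quad i' z = quad i' x' by apply/quad_eq; rewrite -Q'E.
  apply: contrapT => nVO.
  have := @ancestor_below i i' z; rewrite (ancestor_quad zx) (ancestor_quad zx') ai ai'.
  (* If [z] avoids [V] and [O], no cube at [z] below scale [i] is selected, while [Q'] is its own
     ancestor at the smaller scale [i']. *)
  move=> /(_ erefl); have -> : (i' <= i)%R by lia.
  move=> /(_ isT) H; suff : i' = i by lia.
  apply: H => j /andP[j1 j2]; split.
    move=> zo; apply: nVO; right; apply/quad_eq.
    by apply: quad_le zo; lia.
  by rewrite zx => st; apply: nVO; left; exact: stopV st.
have leO : leb R n O <= (4^-1)%:E * leb R n (cube_set Q).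
  rewrite !leb_cube ?(ltW (side_quad_gt0 _ _))// -EFinM lee_fin !side_quad.
  have -> : (2 ^ (2 * (i - 1)) = 4^-1 * 2 ^ (2 * i) :> R)%R.
    rewrite mulrBr expfzDr// mulrC; congr (_ * _)%R.
    by rewrite mulr1 (_ : (- 2 = - 2%:Z)%R)// -exprnN -natrX.
  rewrite exprMn ler_wpM2r ?exprn_ge0 ?(ltW (exp2z_gt0 _))//.
  (* Sides shrink by a factor 4, so volumes shrink by [4 ^ n], which is at least 4 in positive
     dimension. *)
  rewrite -[leRHS]expr1; apply: ler_wiXn2l => //.
  by rewrite invf_le1// ler1n.
have lQ : leb R n (cube_set Q) <= leb R n (cube_set Q `\` U Q) + (leb R n V + leb R n O).
  apply: le_trans (le_leb _ _ QU) _; [exact: measurable_cube|by do 2?apply: measurableU|].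
  apply: le_trans (measureU2 _ _ _) _ => //; first exact: measurableU.
  by apply: leeD2l; exact: measureU2.
have lQ' : leb R n (cube_set Q) <= leb R n (cube_set Q `\` U Q) + (2^-1)%:E * leb R n (cube_set Q).
  apply: le_trans lQ _; apply: leeD2l.
  apply: le_trans (leeD leV leO) _.
  rewrite leb_cube ?(ltW (side_quad_gt0 _ _))// -!EFinM -EFinD lee_fin.
  by rewrite -mulrDl ler_wpM2r ?exprn_ge0 ?(ltW (side_quad_gt0 _ _))//; lra.
have := lQ'; rewrite leb_cube ?(ltW (side_quad_gt0 _ _))//.
case: (leb R n (cube_set Q `\` U Q)) (measure_ge0 (leb R n) (cube_set Q `\` U Q)) => [r| |//] _.
  by rewrite -!EFinM -EFinD !lee_fin; lra.
by rewrite gt0_muley ?lte_fin// leey.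
Qed.

End stopping_cubes.

(** * The stopping rule and the pointwise bound within one shifted grid *)

Section one_grid.
Context {R : realType} {n m : nat}.
Hypotheses (n_gt0 : (0 < n)%N) (m_gt0 : (0 < m)%N).
Variables (D S Sb : set (n.-tuple R * R)) (b : {ffun 'I_n -> bool}) (k : nat).
Hypotheses (gD : dyadic_grid D) (SD : S `<=` D) (spS : sparse S) (SbS : Sb `<=` S).
Variable g : 'I_m -> eucl R n -> \bar R.
Hypotheses (mg : forall l, measurable_fun setT (g l)) (g0 : forall l x, 0 <= g l x).
(** For [x] in [Q], the cube P(Q) is [quad (lev Q) x], the same for all such [x] by [lev_sub]. The
    family [Sb] stands for the cubes of [S] assigned to the grid [b]. *)
Variable lev : n.-tuple R * R -> int.
Notation quad := (quad b).
Hypothesis lev_sub : forall Q x, Sb Q -> cube_set Q x ->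
  cube_set Q `<=` cube_set (quad (lev Q) x).
Hypothesis lev_le : forall Q, Sb Q -> (2 ^ (2 * lev Q) <= 2 ^+ k.+3 * side Q)%R.
Hypothesis lev_gt : forall Q, Sb Q -> (side Q < 2 ^ (2 * lev Q))%R.
Implicit Types (Q : n.-tuple R * R) (x : n.-tuple R) (i : int).

Definition below Q0 : set (n.-tuple R * R) :=
  [set Q | [/\ Sb Q, cube_set Q `<=` cube_set Q0 &
     forall x, cube_set Q x -> cube_set (quad (lev Q) x) `<=` cube_set Q0]].

(** Chosen so that the loss [3 ^ n] of [near_cover] times the fraction [2 / overlap] from the
    Carleson property equals [1 / 8]. *)
Definition overlap := (16 * 3 ^ n)%N.

Definition crowded Q0 : set (n.-tuple R * R) :=
  [set Q | S Q /\ forall x, cube_set Q x ->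
    overlap%:R%:E <= \esum_(Q' in below Q0) ((\1_(cube_set Q') x)%:E : \bar R)].

(** The threshold [8 * m] lets the [m] functions fill together at most an eighth of [Q0]. In the
    second alternative [P] and [Q] come from different grids, so they are only asked to meet. *)
Definition stop Q0 P : Prop :=
  (exists l, (8 * m)%:R%:E * mean (g l) Q0 < mean (g l) P) \/
  exists Q, [/\ crowded Q0 Q, cube_set P `&` cube_set Q !=set0 & (side P <= side Q)%R].

Lemma overlap_gt0 : (0 < overlap)%N.
Proof. by rewrite /overlap muln_gt0 expn_gt0. Qed.

(** Outside [Q0] the overlap sum vanishes, whereas [overlap] is positive. *)
Lemma crowded_sub Q0 Q : crowded Q0 Q -> cube_set Q `<=` cube_set Q0.
Proof.
move=> [SQ cQ] x Qx; apply: contrapT => Q0x.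
have := cQ x Qx; rewrite esum1; first by rewrite lee_fin lern0 gtn_eqF// overlap_gt0.
move=> Q' [_ Q'Q0 _]; rewrite indicE memNset//.
by move=> /Q'Q0.
Qed.

(** [V] joins the level sets of the [m] maximal functions to a neighbourhood of the crowded cubes,
    each part filling at most an eighth. A cube that meets a crowded cube [Q] and is no larger lies
    within distance [side Q] of it. *)
Lemma stop_small i x : exists V : set (eucl R n),
  [/\ measurable V,
      forall i' z, (i' < i)%R -> cube_set (quad i x) z ->
        stop (quad i x) (quad i' z) -> V z &
      leb R n V <= (4^-1)%:E * leb R n (cube_set (quad i x))].
Proof.
set Q0 := quad i x; have Q00 : (0 < side Q0)%R := side_quad_gt0 b i x.
have crD : crowded Q0 `<=` D by move=> Q [/SD].
have crM Q : crowded Q0 Q -> (side Q <= side Q0)%R.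
  move=> cQ; apply: cube_subset_side => //; last exact: crowded_sub.
    by apply: ltW; apply: (dyadic_side_gt0 gD); exact: crD.
  exact: ltW.
have [V [mV nearV leV]] := near_cover n_gt0 gD crD crM.
pose G l := [set Q | [/\ grid b Q, cube_set Q `<=` cube_set Q0 &
   (8 * m)%:R%:E * mean (g l) Q0 < mean (g l) Q]].
pose W l : set (eucl R n) := \bigcup_(Q in G l) cube_set Q.
have mW l : measurable (W l).
  by apply: (measurable_cubes (grid_dyadic b)) => Q [].
have mWs : measurable (\bigcup_(l in [set: 'I_m]) W l).
  by apply: fin_bigcup_measurable.
exists ((\bigcup_(l in [set: 'I_m]) W l) `|` V); split.
- exact: measurableU.
- move=> i' z i'i Q0z [[l lt]|[Q [cQ [y [Py Qy]] PQ]]].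
    left; exists l => //; exists (quad i' z); last exact: mem_quad.
    split => //; first exact: grid_quad.
    have -> : Q0 = quad i z by apply/esym/quad_eq.
    by apply: cube_at_sub; lia.
  right; apply: (nearV Q y z) => // l.
  apply: lt_le_trans PQ.
  have := Py l; have := mem_quad b i' z l.
  move: (corner _ _) (side _) => c s /andP[? ?] /andP[? ?].
  by rewrite ltr_norml; apply/andP; split; lra.
apply: le_trans (measureU2 _ _ _) _ => //.
have -> : 4^-1%:E = (8^-1)%:E + (8^-1)%:E :> \bar R by rewrite -EFinD; congr EFin; lra.
rewrite ge0_muleDl ?lee_fin//; apply: leeD.
  have cm : countable [set: 'I_m] by [].
  apply: le_trans (measure_countable_subadditive _ cm _) _ => //.
  apply: (@le_trans _ _ (m%:R%:E * (((8 * m)%:R^-1)%:E * leb R n (cube_set Q0)))).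
    apply: esum_card_le.
    - by rewrite mule_ge0// lee_fin.
    - move=> l _; apply: (dyadic_maximal_le n_gt0 (grid_dyadic b) (mg l) (g0 l)) => //.
      by rewrite ltr0n muln_gt0.
    - move=> s us _; rewrite -[leqRHS](card_ord m) -(card_uniqP us); exact: max_card.
  rewrite muleA -EFinM; apply: lee_wpmul2r => //.
  rewrite lee_fin natrM invfM mulrCA divff ?mulr1//.
  by rewrite pnatr_eq0 -lt0n.
apply: (le_trans leV).
have o0 : (0 < overlap%:R :> R)%R by rewrite ltr0n overlap_gt0.
apply: (@le_trans _ _ ((3 ^+ n)%:E * ((2 / overlap%:R)%:E * leb R n (cube_set Q0)))).
  apply: lee_wpmul2l; first by rewrite lee_fin exprn_ge0.
  apply: (sparse_overlap_le gD SD spS) => //; first by move=> Q [/SbS].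
  by move=> Q [].
rewrite muleA -EFinM; apply: lee_wpmul2r => //; rewrite lee_fin /overlap natrM natrX.
rewrite le_eqVlt; apply/orP; left; apply/eqP; field.
by rewrite expf_neq0.
Qed.

Notation anc := (ancestor b stop).

(** Order the cubes by decreasing side. The first [overlap] of them make the last of these crowded;
    [k.+3] cubes further on, P(Q) is no larger than that crowded cube and must stop, so its ancestor
    cannot be [i]. *)
Lemma anc_count x i (s : seq (n.-tuple R * R)) : uniq s ->
  (forall Q, Q \in s -> [/\ Sb Q, cube_set Q x & anc (lev Q) x = i]) ->
  (size s <= overlap + k.+2)%N.
Proof.
move=> us0 sP0; rewrite leqNgt; apply/negP => szs.
pose le := fun Q Q' : n.-tuple R * R => (side Q' <= side Q)%R.
have le_tot : total le by move=> Q Q'; exact: le_total.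
have le_tr : transitive le by move=> Q Q' Q'' a c; exact: le_trans c a.
have srt := sort_sorted le_tot s.
have us : uniq (sort le s) by rewrite sort_uniq.
have sP Q : Q \in sort le s -> [/\ Sb Q, cube_set Q x & anc (lev Q) x = i].
  by rewrite mem_sort; exact: sP0.
have sz : (overlap + k.+2 < size (sort le s))%N by rewrite size_sort.
move: (sort le s) srt us sP sz => {s us0 sP0 szs} s srt us sP sz.
have [Qd _] : exists Q, Q \in s.
  by case: s sz {srt us sP} => // Q s _; exists Q; rewrite mem_head.
pose q := nth Qd s.
have qs j : (j < size s)%N -> [/\ Sb (q j), cube_set (q j) x & anc (lev (q j)) x = i].
  by move=> js; apply: sP; exact: mem_nth.
have qD j : (j < size s)%N -> D (q j) by move=> /qs[/SbS/SD].
have qle j j' : (j <= j' < size s)%N -> (side (q j') <= side (q j))%R.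
  move=> /andP[jj' js]; apply: (sorted_leq_nth le_tr _ Qd srt) => //; rewrite ?inE//.
    by move=> Q; exact: lexx.
  exact: leq_ltn_trans jj' js.
have [hD _ _] := gD.
(* Distinct cubes of [D] through [x] have distinct sides, which are powers of two. *)
have qstep j : (j.+1 < size s)%N -> (2 * side (q j.+1) <= side (q j))%R.
  move=> js; have js' : (j < size s)%N by exact: ltnW.
  have le1 : (side (q j.+1) <= side (q j))%R by apply: qle; rewrite leqnSn.
  have ne : side (q j.+1) != side (q j).
    apply/eqP => e; have [[_ x1 _] [_ x2 _]] := (qs _ js, qs _ js').
    have /eqP := dyadic_same_side gD (qD _ js) (qD _ js') e x1 x2.
    by rewrite nth_uniq// gtn_eqF.
  have [[j1 E1] [j2 E2]] := (hD _ (qD _ js), hD _ (qD _ js')).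
  have : (side (q j.+1) < side (q j))%R by rewrite lt_neqAle ne.
  rewrite E1 E2 ltr_eXz2l ?ltr1n// => jj.
  rewrite -[X in (X * _)%R](expr1z (2 : R)) -expfzDr// ler_eXz2l ?ltr1n//; lia.
have o0 := overlap_gt0.
have qpow t : (overlap.-1 + t < size s)%N ->
    (2 ^+ t * side (q (overlap.-1 + t)%N) <= side (q overlap.-1))%R.
  elim: t => [|t IH]; first by rewrite addn0 expr0 mul1r.
  rewrite addnS => ts; apply: le_trans (IH (ltnW ts)).
  by rewrite exprSr -mulrA ler_pM2l ?exprn_gt0//; exact: qstep.
(* Indices start at 0: [q a] is the cube number [overlap], and [c] equals [overlap + k.+2], still
   below the size assumed for contradiction. *)
set a := overlap.-1; set c := (a + k.+3)%N.
have cs : (c < size s)%N by rewrite /c /a; lia.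
have as_ : (a < size s)%N by rewrite /a; lia.
have [SQa Qax anca] := qs _ as_; have [SQc Qcx ancc] := qs _ cs.
have crowd : crowded (quad i x) (q a).
  split=> [|y Qay]; first exact: SbS.
  apply: esum_ge; exists [set` take overlap s].
    split; first exact: finite_seq.
    move=> Q /= /(nthP Qd)[j]; rewrite size_take_min leq_min => /andP[jo js].
    rewrite nth_take// -/(q j) => <-.
    have [SQ Qx ai] := qs _ js.
    have sub : cube_set (quad (lev (q j)) x) `<=` cube_set (quad i x).
      by apply: cube_at_sub; have := ancestor_ge b stop (lev (q j)) x; rewrite ai; lia.
    split=> // [z /(lev_sub SQ Qx)/sub//|z Qz].
    suff -> : quad (lev (q j)) z = quad (lev (q j)) x by [].
    by apply/quad_eq; exact: lev_sub SQ Qx _ Qz.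
  rewrite -fsbig_seq ?take_uniq//.
  have -> : \sum_(Q <- take overlap s) ((\1_(cube_set Q) y)%:E : \bar R) =
            \sum_(Q <- take overlap s) (1%:E : \bar R).
    apply: eq_big_seq => Q /(nthP Qd)[j]; rewrite size_take_min leq_min => /andP[jo js].
    rewrite nth_take// -/(q j) => <-.
    rewrite indicE mem_set//; have [SQ Qx ai] := qs _ js.
    apply: (dyadic_subset n_gt0 gD (qD _ as_) (qD _ js) _ Qax Qx) => //.
    by apply: qle; rewrite /a as_ andbT; lia.
  rewrite sumEFin big_const_seq count_predT iter_addr_0 size_takel//; lia.
have sc : (side (quad (lev (q c)) x) <= side (q a))%R.
  by apply: le_trans (lev_le SQc) _; exact: qpow.
have st : stop (quad i x) (quad (lev (q c)) x).
  by right; exists (q a); split=> //; exists x; split=> //; exact: mem_quad.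
(* The selected cube itself may satisfy the stopping condition. That case is excluded by size:
   P([q a]) is strictly larger than [q a] but would be no larger than [quad i x]. *)
have [ec|nc] := eqVneq (lev (q c)) i; last first.
  have := @ancestor_nostop _ _ b stop (lev (q c)) x; rewrite ancc; apply => //.
  by move=> e; move: nc; rewrite e eqxx.
have := lev_gt SQa; rewrite ltNge => /negP; apply.
apply: le_trans sc; rewrite side_quad ler_eXz2l ?ltr1n//.
by have := ancestor_ge b stop (lev (q a)) x; rewrite anca ec; lia.
Qed.

(** These stand for the products of averages over the dilated cube and over the cube itself, with
    [K] the loss when passing to a selected ancestor. *)
Variables (w a : n.-tuple R * R -> \bar R) (K : R).
Hypotheses (K0 : (0 <= K)%R) (a0 : forall Q, 0 <= a Q) (w0 : forall Q, 0 <= w Q).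
Hypothesis wa : forall Q x i, Sb Q -> cube_set Q x -> 
  (forall l, mean (g l) (quad (lev Q) x) <= (8 * m)%:R%:E * mean (g l) (quad i x)) ->
  w Q <= K%:E * a (quad i x).

(** Group the cubes through [x] by their selected ancestor: [anc_count] bounds the size of a group
    and [wa] each of its terms. *)
Lemma one_grid_pointwise x :
  \esum_(Q in Sb) (w Q * (\1_(cube_set Q) x)%:E) <=
  ((overlap + k.+2)%:R * K)%:E *
     \esum_(P in selected b stop) (a P * (\1_(cube_set P) x)%:E).
Proof.
pose I := [set i | anc i x = i].
pose Z i := [set Q | [/\ Sb Q, cube_set Q x & anc (lev Q) x = i]].
pose Z0 := [set Q | Sb Q /\ cube_set Q x].
have c0 : (0 <= (overlap + k.+2)%:R * K)%R by rewrite mulr_ge0.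
apply: (@le_trans _ _ (\esum_(Q in Z0) w Q)).
  rewrite esum_mkcond [leRHS]esum_mkcond; apply: le_esum => Q _.
  have [/set_mem SQ|nS] := boolP (Q \in Sb); last first.
    by case: ifP => // _; exact: w0.
  rewrite indicE; have [/set_mem Qx|] := boolP (x \in _).
    by rewrite mule1 mem_set.
  by rewrite mule0; case: ifP.
rewrite (reindex_esum (I `*`` Z) Z0 snd); last first.
  split=> [[i Q] /= [Ii [SQ Qx _]]//|[i Q] [i' Q']|Q [SQ Qx]].
    by move=> /set_mem[/= _ [_ _ <-]] /set_mem[/= _ [_ _ <-]] /= ->.
  by exists (anc (lev Q) x, Q) => //; split=> //=; exact: ancestor_idem.
rewrite -(esum_esum (a := fun i Q => w Q))//.
apply: (@le_trans _ _ (\esum_(i in I) (((overlap + k.+2)%:R * K)%:E * a (quad i x)))).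
  apply: le_esum => i Ii; rewrite EFinM -muleA; apply: esum_card_le.
  - by rewrite mule_ge0 ?lee_fin.
  - move=> Q [SQ Qx ai]; apply: wa => // l.
    (* If P(Q) is the ancestor itself, the factor [8 * m] is at least 1; otherwise P(Q) did not
       stop, which bounds its means. *)
    have [/eqP e|/eqP e] := eqVneq (lev Q) i.
      rewrite -(eqP e) -[leLHS]mul1e; apply: lee_wpmul2r; first exact: mean_ge0.
      by rewrite lee_fin ler1n muln_gt0.
    have := @ancestor_nostop _ _ b stop (lev Q) x; rewrite ai => ns.
    rewrite leNgt; apply/negP => lt; apply: ns; first by move=> e'; apply: e.
    by left; exists l.
  - by move=> s us sZ; apply: anc_count sZ.
apply: le_trans (esum_scale_le _ _) _ => //.
apply: lee_wpmul2l; first by rewrite lee_fin.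
(* Different scales give different cubes, so each selected cube through [x] is counted once. *)
rewrite -(esum_image I (fun i => quad i x) a); last first.
  move=> i i' _ _ /(congr1 side); rewrite !side_quad => /exp2z_inj; lia.
apply: esum_subset => [_ [i Ii <-]|_ [i Ii <-]]; first by exists i, x.
by rewrite indicE mem_set ?mule1//; exact: mem_quad.
Qed.

End one_grid.

(** * Comparison of averages and of their products *)

Section averages.
Context {R : realType} {n m : nat}.
Implicit Types Q : n.-tuple R * R.

Lemma average_ge0 (p0 : R) (h : eucl R n -> R) Q : 0 <= average p0 h Q.
Proof. exact: poweR_ge0. Qed.

(** The root turns [c] into its power [p0^-1], which is at most [c] because [c] and [p0] are at
    least 1. *)
Lemma average_le (p0 c : R) (h : eucl R n -> R) Q Q' :
  (1 <= p0)%R -> (1 <= c)%R ->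
  mean (fun x => (`|h x| `^ p0)%:E) Q <= c%:E * mean (fun x => (`|h x| `^ p0)%:E) Q' ->
  average p0 h Q <= c%:E * average p0 h Q'.
Proof.
move=> p1 c1 le; set g := (fun x => _) in le.
have p0_gt0 : (0 < p0)%R by exact: lt_le_trans p1.
have g0 x : 0 <= g x by rewrite lee_fin powR_ge0.
have c0 : (0 <= c)%R by exact: le_trans c1.
apply: (@le_trans _ _ ((c%:E * mean g Q') `^ p0^-1)).
  apply: gt0_ler_poweR le; rewrite ?invr_ge0 ?(ltW p0_gt0)// in_itv/= leey andbT.
    exact: mean_ge0.
  by rewrite mule_ge0 ?lee_fin// mean_ge0.
rewrite poweRM ?lee_fin ?mean_ge0//; apply: lee_wpmul2r; first exact: poweR_ge0.
rewrite poweR_EFin lee_fin -[leRHS](powRr1 c0); apply: ler_powR => //.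
by rewrite invf_le1.
Qed.

Lemma prod_average_le (p0 c : R) (f : 'I_m -> eucl R n -> R) Q Q' :
  (1 <= p0)%R -> (1 <= c)%R ->
  (forall l, mean (fun x => (`|f l x| `^ p0)%:E) Q <=
     c%:E * mean (fun x => (`|f l x| `^ p0)%:E) Q') ->
  \big[*%E/1]_(i < m) average p0 (f i) Q <=
    (c ^+ m)%:E * \big[*%E/1]_(i < m) average p0 (f i) Q'.
Proof.
move=> p1 c1 le; have c0 : (0 <= c)%R by exact: le_trans c1.
have le' l : average p0 (f l) Q <= c%:E * average p0 (f l) Q' by exact: average_le.
have -> : (c ^+ m)%:E = \big[*%E/1]_(i < m) c%:E.
  by rewrite prodEFin prodr_const card_ord.
rewrite -big_split/=.
(* Nonnegativity is carried through the induction because multiplying inequalities requires it. *)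
have : 0 <= \big[*%E/1]_(i < m) average p0 (f i) Q <= \big[*%E/1]_(i < m) (c%:E * average p0 (f i) Q').
  elim/big_rec2: _ => [|i y1 y2 _ /andP[h1 h2]]; first by rewrite lee01 lexx.
  by rewrite mule_ge0 ?average_ge0//= lee_pmul// average_ge0.
by case/andP.
Qed.

End averages.

(** * Pointwise domination by the sum over all shifted grids *)

Section pointwise.
Context {R : realType} {n m : nat}.
Hypotheses (n_gt0 : (0 < n)%N) (m_gt0 : (0 < m)%N).
Implicit Types Q : n.-tuple R * R.

Lemma side_dilate k Q : side (dilate k Q) = (2 ^+ k * side Q)%R.
Proof. by []. Qed.

Lemma cube_sub_dilate k Q : (0 <= side Q)%R -> cube_set Q `<=` cube_set (dilate k Q).
Proof.
move=> s0 x Qx l; have /andP[x1 x2] := Qx l.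
rewrite side_dilate /corner /= tnth_mktuple -!/(corner _ _).
have k1 : (side Q <= 2 ^+ k * side Q)%R by rewrite ler_peMl// exprn_ege1// ler1n.
by apply/andP; split; lra.
Qed.

Lemma dyadic_top (D : set (n.-tuple R * R)) k Q : dyadic_grid D -> D Q ->
  exists (bi : {ffun 'I_n -> bool} * int),
    [/\ forall x, cube_set Q x ->
          cube_set (dilate k Q) `<=` cube_set (quad bi.1 bi.2 x),
        (2 ^ (2 * bi.2) <= 2 ^+ k.+3 * side Q)%R &
        (side Q < 2 ^ (2 * bi.2))%R].
Proof.
move=> gD DQ; have [hD _ _] := gD; have [j sQ] := hD _ DQ.
have sQ0 := dyadic_side_gt0 gD DQ.
have [i [i1 i2]] : exists i : int, (k%:Z + j + 2 <= 2 * i)%R /\ (2 * i <= k%:Z + j + 3)%R.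
  (* One of two consecutive exponents is even. The lower one already gives a side at least four
     times that of the dilated cube, more than the three that [grid_cover] asks; parity accounts for
     [k.+3]. *)
  exists ((k%:Z + j + 3) %/ 2)%Z; lia.
have e2 (p : nat) : (2 ^+ p * side Q = 2 ^ (p%:Z + j) :> R)%R.
  by rewrite sQ expfzDr.
have le3 : (side (dilate k Q) <= 2 ^ (2 * i) / 3)%R.
  rewrite side_dilate e2.
  have : (2 ^ (k%:Z + j + 2) <= 2 ^ (2 * i) :> R)%R by rewrite ler_eXz2l ?ltr1n.
  rewrite (expfzDr _ 2)// -[(2 ^ 2%:Z)%R]/((2 * 2)%R : R).
  have := @exp2z_gt0 R (k%:Z + j)%R; lra.
have [b [z zQ]] := grid_cover le3.
exists (b, i); split => [x Qx||] /=.
- have /in_gcube zE := zQ _ (cube_sub_dilate k (ltW sQ0) Qx).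
  by rewrite /quad /cube_at zE.
- by rewrite e2 ler_eXz2l ?ltr1n//; lia.
- by rewrite sQ ltr_eXz2l ?ltr1n//; lia.
Qed.

Lemma pointwise_domination (p0 : R) : (1 <= p0)%R -> exists C : R, (0 < C)%R /\
  forall (k : nat) (D S : set (n.-tuple R * R)) (f : 'I_m -> eucl R n -> R),
    dyadic_grid D -> S `<=` D -> sparse S ->
    (forall i, measurable_fun setT (f i)) ->
    exists S' : {ffun 'I_n -> bool} -> set (n.-tuple R * R),
      (forall b, S' b `<=` grid b /\ sparse (S' b)) /\
      forall x, opT k p0 S f x <= (C * k.+1%:R)%:E * \sum_b opA p0 (S' b) f x.
Proof.
(* [8 ^ n] bounds the volume of P(Q) relative to the dilated cube, and [8 * m] is the stopping
   threshold. *)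
move=> p1; pose c : R := ((8 ^+ n) * (8 * m)%:R)%R.
have c1 : (1 <= c)%R.
  rewrite mulr_ege1 ?ler1n ?muln_gt0//.
  by apply: exprn_ege1; lra.
have c0 : (0 < c)%R by exact: lt_le_trans c1.
(* The count [overlap + k.+2] is at most [(overlap + 2) * k.+1], which makes the dependence on [k]
   linear. *)
pose C : R := ((@overlap n + 2)%:R * c ^+ m)%R.
exists C; split; first by rewrite mulr_gt0// ?exprn_gt0// ltr0n addnS.
move=> k D S f gD SD spS mf.
have H Q : exists bi : {ffun 'I_n -> bool} * int, S Q ->
    [/\ forall x, cube_set Q x ->
          cube_set (dilate k Q) `<=` cube_set (quad bi.1 bi.2 x),
        (2 ^ (2 * bi.2) <= 2 ^+ k.+3 * side Q)%R &
        (side Q < 2 ^ (2 * bi.2))%R].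
  have [/SD DQ|nS] := pselect (S Q); last by exists ([ffun=> true], 0%R).
  by have [bi Hbi] := dyadic_top k gD DQ; exists bi.
have [bl Hbl] := choice H.
pose lev Q := (bl Q).2; pose Sb b := [set Q | S Q /\ (bl Q).1 = b].
have SbS b : Sb b `<=` S by move=> Q [].
pose g l x : \bar R := (`|f l x| `^ p0)%:E.
have g0 l x : 0 <= g l x by rewrite lee_fin powR_ge0.
have mg l : measurable_fun setT (g l).
  apply/measurable_EFinP; apply: (measurableT_comp (measurable_powR _)).
  exact: measurableT_comp.
pose st b := stop S (Sb b) b g lev.
have sd Q : S Q -> (0 < side Q)%R by move=> /SD; exact: dyadic_side_gt0.
have lev_sub b Q x : Sb b Q -> cube_set Q x -> cube_set Q `<=` cube_set (quad b (lev Q) x).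
  move=> [SQ <-] Qx; have [sub _ _] := Hbl _ SQ.
  by apply: subset_trans (sub _ Qx); apply: cube_sub_dilate; exact/ltW/sd.
have lev_le b Q : Sb b Q -> (2 ^ (2 * lev Q) <= 2 ^+ k.+3 * side Q)%R.
  by move=> [/Hbl[]].
have lev_gt b Q : Sb b Q -> (side Q < 2 ^ (2 * lev Q))%R by move=> [/Hbl[]].
exists (fun b => selected b (st b)); split=> [b|x].
  split; first exact: selected_grid.
  apply: sparse_selected => // i x.
  exact: (stop_small n_gt0 m_gt0 b gD SD spS (SbS b) mg g0).
pose w Q := \big[*%E/1]_(i < m) average p0 (f i) (dilate k Q).
pose a Q := \big[*%E/1]_(i < m) average p0 (f i) Q.
have w0 Q : 0 <= w Q by apply: prode_ge0 => i _; exact: average_ge0.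
have a0 Q : 0 <= a Q by apply: prode_ge0 => i _; exact: average_ge0.
have main b : \esum_(Q in Sb b) (w Q * (\1_(cube_set Q) x)%:E) <=
    (C * k.+1%:R)%:E * opA p0 (selected b (st b)) f x.
  apply: (@le_trans _ _ (((@overlap n + k.+2)%:R * c ^+ m)%:E * opA p0 (selected b (st b)) f x)).
    apply: (one_grid_pointwise n_gt0 m_gt0 gD SD (SbS b) g0 (lev_sub b) (lev_le b) (lev_gt b)) => //.
      by rewrite exprn_ge0// ltW.
    move=> Q y i SQ Qy le; apply: prod_average_le => // l.
    have [sub lle _] := Hbl _ SQ.1; have sQ := sd _ SQ.1.
    apply: (@le_trans _ _ ((8 ^+ n)%:E * mean (g l) (quad b (lev Q) y))).
      have kQ : (0 < side (dilate k Q))%R.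
        by rewrite side_dilate mulr_gt0// exprn_gt0.
      apply: (mean_subset (mg l) (g0 l) kQ (side_quad_gt0 _ _ _)).
      - rewrite side_quad; apply: (le_trans lle).
        by rewrite side_dilate !exprS; lra.
      - by rewrite -SQ.2; exact: sub.
    rewrite /c EFinM -muleA; apply: lee_wpmul2l; last exact: le.
    by rewrite lee_fin exprn_ge0.
  apply: lee_wpmul2r; first by apply: esum_ge0 => Q _; rewrite mule_ge0 ?lee_fin// a0.
  rewrite lee_fin /C mulrAC; apply: ler_wpM2r; first by rewrite exprn_ge0// ltW.
  by rewrite -natrM ler_nat; lia.
rewrite ge0_sume_distrr; last first.
  by move=> b _; apply: esum_ge0 => Q _; rewrite mule_ge0 ?lee_fin// a0.
apply: le_trans; last by apply: lee_sum => b _; exact: main b.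
(* Each cube of [S] is assigned to exactly one grid, so the inner sum has a single possibly nonzero
   term. *)
have -> : opT k p0 S f x = \esum_(Q in S) \sum_b
    (if Q \in Sb b then w Q * (\1_(cube_set Q) x)%:E else 0).
  apply: eq_esum => Q SQ; rewrite (bigD1 (bl Q).1)//= mem_set//.
  rewrite [X in _ = (_ + X)%R]big1 ?addr0// => b nb.
  by rewrite memNset// => -[_ e]; move: nb; rewrite e eqxx.
rewrite esum_sum; last by move=> Q b _ _; case: ifP => // _; rewrite mule_ge0 ?lee_fin.
apply: lee_sum => b _; rewrite -esum_mkcondr.
by apply: esum_subset => // Q [].
Qed.

End pointwise.

(** * From pointwise to quasi-norm domination *)

Section quasi_norm.
Context {R : realType} {n : nat}.
Variable X : qbfs R n.
Implicit Types (F : eucl R n -> \bar R) (g h : eucl R n -> R).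
Notation mem := (@qbfs_mem R n X).
Notation N := (@qbfs_norm R n X).

Lemma qnormE F g : mem g -> {ae leb R n, forall x, F x = (g x)%:E} ->
  qnorm X F = (N g)%:E.
Proof.
move=> Xg Fg; apply/le_anti/andP; split.
  by apply: ereal_inf_lbound; exists g.
apply: le_ereal_inf_tmp => _ [h [Xh Fh] <-]; rewrite lee_fin.
apply: (qbfs_lattice (qbfs_measurable Xg) Xh _).2.
by apply: filterS2 Fg Fh => x e1 e2; have [->] := etrans (esym e1) e2.
Qed.

Lemma qnorm_lty F : qnorm X F < +oo ->
  exists g, mem g /\ {ae leb R n, forall x, F x = (g x)%:E}.
Proof.
by move=> /ereal_inf_lt[_ [g Xg _] _]; exists g.
Qed.

Lemma qbfs_mem0 : mem (fun=> 0%R).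
Proof.
have := @qbfs_indic R n X set0 measurable0 (ex_intro _ 0%R (fun x => False_ind _)).
by rewrite indic0.
Qed.

(** The quasi-triangle inequality is iterated at the cost of one factor [K] per summand; taking [K]
    at least 1 keeps its powers from shrinking the earlier terms. *)
Lemma qbfs_norm_sum : exists K : R, (1 <= K)%R /\
  forall (I : eqType) (s : seq I) (h : I -> eucl R n -> R), (forall i, mem (h i)) ->
    mem (fun x => \sum_(i <- s) h i x)%R /\
    (N (fun x => \sum_(i <- s) h i x) <= K ^+ size s * \sum_(i <- s) N (h i))%R.
Proof.
have [C0 HC] := qbfs_quasi_triangle X; pose K := Num.max C0 1%R.
have K1 : (1 <= K)%R by rewrite /K le_max lexx orbT.
exists K; split => // I s h Xh; elim: s => [|i s [IHm IHn]] /=.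
  under eq_fun do rewrite big_nil; split; first exact: qbfs_mem0.
  rewrite big_nil mulr0 (qbfs_norm_eq0 qbfs_mem0).2//.
  exact: aeW.
have -> : (fun x => \sum_(i <- i :: s) h i x)%R = (fun x => h i x + \sum_(i <- s) h i x)%R.
  by apply/funext => x; rewrite big_cons.
split; first exact: (qbfs_add (Xh i) IHm).
have s0 : (0 <= \sum_(i <- s) N (h i))%R.
  by apply: sumr_ge0 => j _; exact: qbfs_norm_ge0.
have i0 : (0 <= N (h i))%R by exact: qbfs_norm_ge0.
apply: le_trans (HC _ _ (Xh i) IHm) _.
apply: (@le_trans _ _ (K * (N (h i) + N (fun x => \sum_(i <- s) h i x)))%R).
  by rewrite ler_wpM2r ?le_max ?lexx// addr_ge0//; exact: qbfs_norm_ge0.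
rewrite big_cons exprS -mulrA ler_wpM2l ?(le_trans ler01 K1)// mulrDr lerD//.
by rewrite ler_peMl// exprn_ege1.
Qed.

(** The sum of quasi-norms is at most the number of terms times the largest one, so a single member
    of the family suffices. *)
Lemma qnorm_le_sum : exists K : R, (0 < K)%R /\
  forall (I : finType) (i0 : I) F (G : I -> eucl R n -> \bar R) (c : R), (0 < c)%R ->
    measurable_fun setT F -> (forall x, 0 <= F x) ->
    (forall x, F x <= c%:E * \sum_i G i x) ->
    exists i, qnorm X F <= (K ^+ #|I| * #|I|%:R * c)%:E * qnorm X (G i).
Proof.
have [K [K1 HK]] := qbfs_norm_sum; have K0 : (0 < K)%R by exact: lt_le_trans K1.
exists K; split => // I i0 F G c c0 mF F0 FG.
have I0 : (0 < #|I|)%N by apply/card_gt0P; exists i0.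
(* A member of infinite quasi-norm makes the right-hand side infinite, its coefficient being
   positive. *)
have [[i Gi]|noy] := pselect (exists i, qnorm X (G i) = +oo).
  exists i; rewrite Gi gt0_muley ?leey// lte_fin !mulr_gt0 ?exprn_gt0 ?ltr0n//.
have H i : exists g, mem g /\ {ae leb R n, forall x, G i x = (g x)%:E}.
  apply: qnorm_lty; rewrite ltey; apply/eqP => e; apply: noy; by exists i.
have [h Hh] := choice H.
have Xh i : mem (h i) by have [] := Hh i.
have aeh : {ae leb R n, forall x, forall i, G i x = (h i x)%:E}.
  apply: filter_forall => i; exact: (Hh i).2.
have [j _ jmax] := @arg_maxP _ _ I i0 xpredT (fun i => N (h i)) isT.
have [Xs Ns] := HK _ (index_enum I) h Xh.
have Xcs := qbfs_scale c Xs.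
(* Almost everywhere the bound is finite, hence so is [F], and its real part is a representative to
   which the lattice property applies. *)
have Fle : {ae leb R n, forall x, F x = (fine (F x))%:E /\
    (`|fine (F x)| <= `|c * \sum_i h i x|)%R}.
  apply: filterS aeh => x Gh.
  have := FG x; under eq_bigr do rewrite Gh.
  rewrite sumEFin -EFinM => le.
  have Ff : F x \is a fin_num by rewrite ge0_fin_numE// (le_lt_trans le)// ltey.
  split; first by rewrite fineK.
  rewrite ger0_norm ?fine_ge0//; apply: le_trans (ler_norm _).
  by rewrite -lee_fin fineK.
have mfF : measurable_fun setT (fine \o F) by exact: measurableT_comp.
have Ffine : {ae leb R n, forall x, F x = ((fine \o F) x)%:E}.
  by apply: filterS Fle => x [].
have Fc : {ae leb R n, forall x, (`|(fine \o F) x| <= `|c * \sum_i h i x|)%R}.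
  by apply: filterS Fle => x [].
have [XF NF] := qbfs_lattice mfF Xcs Fc.
exists j; rewrite (qnormE XF Ffine) (qnormE (Xh j) (Hh j).2).
rewrite -EFinM lee_fin; apply: le_trans NF _.
rewrite qbfs_normZ// gtr0_norm// mulrC mulrAC ler_wpM2r ?(ltW c0)//.
apply: le_trans Ns _; rewrite -mulrA [size _](_ : _ = #|I|); last by rewrite cardE enumT.
rewrite ler_wpM2l ?exprn_ge0 ?(ltW K0)//.
rewrite mulr_natl -sumr_const; apply: ler_sum => i _; exact: jmax.
Qed.

End quasi_norm.

(** * Measurability of the operator and conclusion *)

Lemma measurable_opT (R : realType) (n m k : nat) (p0 : R) (D S : set (n.-tuple R * R))
    (f : 'I_m -> eucl R n -> R) : dyadic_grid D -> S `<=` D ->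
  measurable_fun setT (opT k p0 S f).
Proof.
move=> gD SD; have cS : countable S.
  exact: sub_countable (subset_card_le SD) (countable_dyadic gD).
apply: (measurable_esum cS) => [Q x|Q _].
  apply: mule_ge0; last by rewrite lee_fin.
  by apply: prode_ge0 => i _; exact: average_ge0.
apply: measurable_funeM; apply/measurable_EFinP; apply: measurable_indic.
exact: measurable_cube.
Qed.

Theorem theorem1 (R : realType) (n m : nat) (p0 : R) (X : qbfs R n)
    (n_ge1 : (1 <= n)%N) (m_ge1 : (1 <= m)%N) (p0_ge1 : (1 <= p0)%R) :
  exists C : R, (0 < C)%R /\
    forall (k : nat) (D S : set (n.-tuple R * R)) (f : 'I_m -> eucl R n -> R),
      dyadic_grid D -> S `<=` D -> sparse S ->
      (forall i, measurable_fun setT (f i)) ->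
      exists D' S' : set (n.-tuple R * R),
        [/\ dyadic_grid D', S' `<=` D', sparse S'
          & qnorm X (opT k p0 S f) <=
            (C * k.+1%:R)%:E * qnorm X (opA p0 S' f)].
Proof.
have [C [C0 dom]] := pointwise_domination n_ge1 m_ge1 p0_ge1.
have [K [K0 normK]] := qnorm_le_sum X.
pose I : finType := {ffun 'I_n -> bool}.
have I0 : (0 < #|I|)%N by apply/card_gt0P; exists [ffun=> true].
(* The number of grids, and with it the loss from the quasi-triangle inequality, depends on [n]
   only. *)
exists (K ^+ #|I| * #|I|%:R * C)%R; split.
  by rewrite !mulr_gt0// ?exprn_gt0 ?ltr0n.
move=> k D S f gD SD spS mf; have [S' [HS' le]] := dom k D S f gD SD spS mf.
have T0 x : 0 <= opT k p0 S f x.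
  apply: esum_ge0 => Q _; apply: mule_ge0; last by rewrite lee_fin.
  by apply: prode_ge0 => i _; exact: average_ge0.
have [b leb] := normK I [ffun=> true] _ (fun b => opA p0 (S' b) f) _
  (mulr_gt0 C0 (ltr0Sn R k)) (measurable_opT k p0 f gD SD) T0 le.
exists (grid b), (S' b); have [S'b spb] := HS' b; split=> //.
  exact: grid_dyadic.
by rewrite -[(_ * C * _)%R]mulrA; exact: leb.
Qed.
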